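(* Under the setting, assumptions (A1)–(A2) and the algorithm PDAc-L described in the context, fix any $(x^\star,y^\star)\in\Omega$ and let $J(x,y)=\mathcal L(x,y^\star)-\mathcal L(x^\star,y)$. Then there exists a constant $C_1>0$ such that for every $N\ge1$, $$J(\hat x_N,\hat y_N)\le \frac{C_1}{N},\qquad\text{where } \hat x_N=\frac{1}{s_N}\sum_{n=1}^N\tau_nx_n,\ \hat y_N=\frac1{s_N}\sum_{n=1}^N\tau_ny_n,\ s_N=\sum_{n=1}^N\tau_n.$$
   Context: Let $f:\mathbb{R}^p\to(-\infty,+\infty]$ and $g:\mathbb{R}^q\to(-\infty,+\infty]$ be proper closed convex functions; $f^*(y)=\sup_u\{\langle y,u\rangle-f(u)\}$ is the Fenchel conjugate, $\mathrm{dom}(h)=\{x:h(x)<+\infty\}$, and for $\lambda>0$, $\mathrm{Prox}_{\lambda h}(x)=\arg\min_u\{h(u)+\frac{1}{2\lambda}\|u-x\|^2\}$. Let $\Phi:\mathrm{dom}(g)\times\mathrm{dom}(f^* )\to\mathbb{R}$ be continuous and $\mathcal L(x,y)=g(x)+\Phi(x,y)-f^*(y)$. Let $\Omega$ be the set of $(x^\star,y^\star)\in\mathrm{dom}(g)\times\mathrm{dom}(f^* )$ with $-\nabla_x\Phi(x^\star,y^\star)\in\partial g(x^\star)$ and $\nabla_y\Phi(x^\star,y^\star)\in\partial f^*(y^\star)$. Assume: (A1) $\Omega\neq\emptyset$, $\mathrm{dom}(g)\times\mathrm{dom}(f^* )\subseteq\mathrm{dom}(\Phi)$, and $\mathcal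 L(x^\star,y^\star)$ is finite; (A2) for each $y\in\mathrm{dom}(f^* )$, $\Phi(\cdot,y)$ is convex and differentiable, for each $x\in\mathrm{dom}(g)$, $\Phi(x,\cdot)$ is concave and differentiable, and for all bounded $\mathcal X\subset\mathbb R^q$, $\mathcal Y\subset\mathbb R^p$ there exist $L_{yy},L_{xx}\ge 0$, $L_{xy}>0$ with $\|\nabla_y\Phi(x,y)-\nabla_y\Phi(x,\tilde y)\|\le L_{yy}\|y-\tilde y\|$ and $\|\nabla_x\Phi(x,y)-\nabla_x\Phi(\tilde x,\tilde y)\|\le L_{xx}\|x-\tilde x\|+L_{xy}\|y-\tilde y\|$ for all $x,\tilde x\in\mathcal X\cap\mathrm{dom}(g)$, $y,\tilde y\in\mathcal Y\cap\mathrm{dom}(f^* )$. Algorithm PDAc-L: choose $\psi\in(1,1+\sqrt3)$, $\xi>0$, $\varphi>1$ with $\omega:=2\psi-\xi-\frac{\psi^3\varphi}{1+\psi}>0$, $\tau_{\max}>0$, $\nu\in(0,1)$, $\mu\in(0,1)$, $\eta\in[0,1)$, an integer $M\ge1$, $\beta>0$, $x_0\in\mathrm{dom}(g)$, $y_0\in\mathrm{dom}(f^* )$, $\tau_0\in(0,\tau_{\max}]$; set $z_0=x_0$, $\delta_0=1$. For $n=1,2,\dots$: (1) $z_n=\frac{\psi-1}{\psi}x_{n-1}+\frac1\psi z_{n-1}$ and $x_n=\mathrm{Prox}_{\tau_{n-1}g}(z_n-\tau_{n-1}\nabla_x\Phi(x_{n-1},y_{n-1}))$. (2) Let $\tau=\min\{\varphi\tau_{n-1},\tau_{\max}\}$;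 set $\tau_n=\tau\mu^i$ and $y_n=\mathrm{Prox}_{\beta\tau_n f^*}(y_{n-1}+\beta\tau_n\nabla_y\Phi(x_n,y_{n-1}))$, where $i$ is the smallest nonnegative integer such that $\frac{\tau_n\tau_{n-1}}{\xi}\|\theta_n\|^2+2\tau_n\Phi_n^y\le\nu r_n+(1-\nu)c_n$, with $\theta_n=\nabla_x\Phi(x_n,y_n)-\nabla_x\Phi(x_{n-1},y_{n-1})$, $\Phi_n^y=\Phi(x_n,y_{n-1})+\langle\nabla_y\Phi(x_n,y_{n-1}),y_n-y_{n-1}\rangle-\Phi(x_n,y_n)$, $r_n=\omega\delta_{n-1}\|x_n-x_{n-1}\|^2+\frac1\beta\|y_n-y_{n-1}\|^2$, $c_n=\frac{\eta}{|\mathcal I_n|}\sum_{i\in\mathcal I_n}r_i$, $\mathcal I_n=\{n-1,n-2,\dots,\max\{n-M,1\}\}$ (the $r_i$ for $i<n$ being the values from earlier iterations; for $n=1$, $\mathcal I_1=\emptyset$ and $c_1:=0$). (3) $\delta_n=\tau_n/\tau_{n-1}$. *)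

(* Defs.v *)
From HB Require Import structures.
From mathcomp Require Import all_boot all_order all_algebra.
From mathcomp Require Import all_classical all_reals all_analysis.
Set Implicit Arguments. Unset Strict Implicit. Unset Printing Implicit Defensive.
Import Order.TTheory GRing.Theory Num.Theory.
Import numFieldNormedType.Exports.
Local Open Scope classical_set_scope.
Local Open Scope ring_scope.

Definition dotv (R : realType) (n : nat) (u v : 'rV[R]_n) : R :=
  \sum_(i < n) u 0 i * v 0 i.
Definition norm2 (R : realType) (n : nat) (u : 'rV[R]_n) : R :=
  Num.sqrt (dotv u u).

Definition edom (R : realType) (n : nat) (h : 'rV[R]_n -> \bar R) : set 'rV[R]_n :=
  [set u | (h u < +oo)%E].
Definition proper_fun (R : realType) (n : nat) (h : 'rV[R]_n -> \bar R) : Prop :=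
  (forall u, h u != -oo%E) /\ exists u, (h u < +oo)%E.
Definition convex_efun (R : realType) (n : nat) (h : 'rV[R]_n -> \bar R) : Prop :=
  forall (a b : 'rV[R]_n) (t : R), 0 < t < 1 ->
    (h (t *: a + (1 - t) *: b)%R <= t%:E * h a + (1 - t)%:E * h b)%E.
(* closed = lower semicontinuous = all sublevel sets closed *)
Definition closed_fun (R : realType) (n : nat) (h : 'rV[R]_n -> \bar R) : Prop :=
  forall a : R, closed [set u | (h u <= a%:E)%E].
Definition proper_closed_convex (R : realType) (n : nat) (h : 'rV[R]_n -> \bar R) : Prop :=
  [/\ proper_fun h, closed_fun h & convex_efun h].

Definition fenchel_conj (R : realType) (n : nat) (h : 'rV[R]_n -> \bar R)
  (y : 'rV[R]_n) : \bar R :=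
  ereal_sup [set ((dotv y u)%:E - h u)%E | u in [set: 'rV[R]_n]].

Definition subdiff (R : realType) (n : nat) (h : 'rV[R]_n -> \bar R)
  (x : 'rV[R]_n) : set 'rV[R]_n :=
  [set v | forall u, (h x + (dotv v (u - x))%:E <= h u)%E].

Definition is_prox (R : realType) (n : nat) (lam : R) (h : 'rV[R]_n -> \bar R)
  (x p : 'rV[R]_n) : Prop :=
  forall u, (h p + ((2 * lam)^-1 * norm2 (p - x) ^+ 2)%:E
             <= h u + ((2 * lam)^-1 * norm2 (u - x) ^+ 2)%:E)%E.

Definition ebounded (R : realType) (n : nat) (A : set 'rV[R]_n) : Prop :=
  exists B : R, forall u, A u -> norm2 u <= B.

Definition Lagr (R : realType) (p q : nat) (g : 'rV[R]_q -> \bar R)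
  (f : 'rV[R]_p -> \bar R) (Phi : 'rV[R]_q -> 'rV[R]_p -> R)
  (x : 'rV[R]_q) (y : 'rV[R]_p) : \bar R :=
  (g x + (Phi x y)%:E - fenchel_conj f y)%E.

Definition in_Omega (R : realType) (p q : nat) (g : 'rV[R]_q -> \bar R)
  (f : 'rV[R]_p -> \bar R)
  (gx : 'rV[R]_q -> 'rV[R]_p -> 'rV[R]_q) (gy : 'rV[R]_q -> 'rV[R]_p -> 'rV[R]_p)
  (xs : 'rV[R]_q) (ys : 'rV[R]_p) : Prop :=
  [/\ edom g xs, edom (fenchel_conj f) ys,
      subdiff g xs (- gx xs ys) & subdiff (fenchel_conj f) ys (gy xs ys)].

Definition omega_of (R : realType) (psi xi phi : R) : R :=
  2 * psi - xi - psi ^+ 3 * phi / (1 + psi).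

Definition r_seq (R : realType) (p q : nat) (omega beta : R)
  (x : nat -> 'rV[R]_q) (y : nat -> 'rV[R]_p) (delta : nat -> R) (n : nat) : R :=
  omega * delta n.-1 * norm2 (x n - x n.-1) ^+ 2 + beta^-1 * norm2 (y n - y n.-1) ^+ 2.

Definition c_seq (R : realType) (eta : R) (M : nat) (r : nat -> R) (n : nat) : R :=
  if (n <= 1)%N then 0
  else eta / (n - maxn (n - M) 1)%:R * \sum_(maxn (n - M) 1 <= k < n) r k.

Definition ls_ok (R : realType) (p q : nat) (Phi : 'rV[R]_q -> 'rV[R]_p -> R)
  (gx : 'rV[R]_q -> 'rV[R]_p -> 'rV[R]_q) (gy : 'rV[R]_q -> 'rV[R]_p -> 'rV[R]_p)
  (omega xi nu beta : R) (tprev t dprev : R) (xn xp : 'rV[R]_q)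
  (yp yt : 'rV[R]_p) (cn : R) : Prop :=
  let theta := gx xn yt - gx xp yp in
  let Phiy := Phi xn yp + dotv (gy xn yp) (yt - yp) - Phi xn yt in
  let rn := omega * dprev * norm2 (xn - xp) ^+ 2 + beta^-1 * norm2 (yt - yp) ^+ 2 in
  t * tprev / xi * norm2 theta ^+ 2 + 2 * t * Phiy <= nu * rn + (1 - nu) * cn.

Definition PDAcL_run (R : realType) (p q : nat) (g : 'rV[R]_q -> \bar R)
  (f : 'rV[R]_p -> \bar R) (Phi : 'rV[R]_q -> 'rV[R]_p -> R)
  (gx : 'rV[R]_q -> 'rV[R]_p -> 'rV[R]_q) (gy : 'rV[R]_q -> 'rV[R]_p -> 'rV[R]_p)
  (psi xi phi tau_max nu mu eta beta : R) (M : nat)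
  (x z : nat -> 'rV[R]_q) (y : nat -> 'rV[R]_p) (tau delta : nat -> R) : Prop :=
  let omega := omega_of psi xi phi in
  let fs := fenchel_conj f in
  let r := r_seq omega beta x y delta in
  [/\ edom g (x 0), edom fs (y 0), 0 < tau 0 <= tau_max,
      z 0 = x 0 /\ delta 0 = 1 &
      forall n : nat, (1 <= n)%N ->
      let tbar := Num.min (phi * tau n.-1) tau_max in
      let ytrial (t : R) (yt : 'rV[R]_p) :=
        is_prox (beta * t) fs (y n.-1 + (beta * t) *: gy (x n) (y n.-1)) yt in
      let ok (t : R) (yt : 'rV[R]_p) :=
        ls_ok Phi gx gy omega xi nu beta (tau n.-1) t (delta n.-1) (x n) (x n.-1)
              (y n.-1) yt (c_seq eta M r n) in
      [/\ z n = ((psi - 1) / psi) *: x n.-1 + psi^-1 *: z n.-1,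
          is_prox (tau n.-1) g (z n - tau n.-1 *: gx (x n.-1) (y n.-1)) (x n),
          (exists i : nat,
             [/\ tau n = tbar * mu ^+ i, ytrial (tau n) (y n), ok (tau n) (y n) &
                 forall j : nat, (j < i)%N ->
                   forall yt, ytrial (tbar * mu ^+ j) yt -> ~ ok (tbar * mu ^+ j) yt])
        & delta n = tau n / tau n.-1]].

Definition wavg (R : realType) (n : nat) (tau : nat -> R) (v : nat -> 'rV[R]_n)
  (N : nat) : 'rV[R]_n :=
  (\sum_(1 <= k < N.+1) tau k)^-1 *: \sum_(1 <= k < N.+1) tau k *: v k.

(* Main.v *)
Require Import Defs.
From HB Require Import structures.
From mathcomp Require Import all_boot all_order all_algebra.
From mathcomp Require Import all_classical all_reals all_analysis.
From mathcomp Require Import ring lra zify.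
Import Order.TTheory GRing.Theory Num.Theory.
Import numFieldNormedType.Exports.
Local Open Scope classical_set_scope.
Local Open Scope ring_scope.

(* Adding the prox inequalities for [x_n], [x_(n+1)] and [y_n], a Young inequality and the
   line-search test gives, for a Lyapunov energy [V] built from [|z_(n+2) - xs|^2],
   [|y_n - ys|^2] and [|x_(n+1) - x_n|^2], the recursion
   [2 tau_n J(x_n, y_n) + V_n <= V_(n-1) + (1 - nu) (c_n - r_n)].  Each [r_k] enters the
   later window averages with total weight at most [eta < 1] (up to the first [M] terms), so
   [sum_n (c_n - r_n)] is bounded above; as [J >= 0], the iterates are bounded and
   [sum_n tau_n J(x_n, y_n)] is bounded.  On bounded sets the Lipschitz constants show that a
   rejected trial step cannot be small, so [tau_n] is bounded away from [0], and the rate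
   follows from Jensen's inequality. *)

Set Implicit Arguments.
Unset Strict Implicit.
Unset Printing Implicit Defensive.

(** * Euclidean inner product and norm on row vectors *)

Lemma continuous_sumr {R : realType} {T : topologicalType} {I : finType}
    (F : I -> T -> R) :
  (forall i, continuous (F i)) -> continuous (fun x => \sum_i F i x).
Proof.
move=> cF; apply: (continuous_big (U := R)) => [z|i _]; last exact: cF.
by apply: cvgD; [exact: cvg_fst|exact: cvg_snd].
Qed.

Section EuclideanStructure.
Context {R : realType} {n : nat}.
Implicit Types u v w : 'rV[R]_n.

Lemma dotvC u v : dotv u v = dotv v u.
Proof. by apply: eq_bigr => i _; rewrite mulrC. Qed.

Lemma dotvDl u v w : dotv (u + v) w = dotv u w + dotv v w.
Proof. by rewrite -big_split; apply: eq_bigr => i _; rewrite mxE mulrDl. Qed.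

Lemma dotvZl a u v : dotv (a *: u) v = a * dotv u v.
Proof. by rewrite /dotv mulr_sumr; apply: eq_bigr => i _; rewrite mxE mulrA. Qed.

Lemma dotvNl u v : dotv (- u) v = - dotv u v.
Proof. by rewrite -scaleN1r dotvZl mulN1r. Qed.

Lemma dotvDr u v w : dotv u (v + w) = dotv u v + dotv u w.
Proof. by rewrite dotvC dotvDl !(dotvC u). Qed.

Lemma dotvZr a u v : dotv u (a *: v) = a * dotv u v.
Proof. by rewrite dotvC dotvZl (dotvC u). Qed.

Lemma dotvNr u v : dotv u (- v) = - dotv u v.
Proof. by rewrite dotvC dotvNl (dotvC u). Qed.

Definition dotvE := (dotvDl, dotvDr, dotvNl, dotvNr, dotvZl, dotvZr).

Lemma dotv_ge0 u : 0 <= dotv u u.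
Proof. by apply: sumr_ge0 => i _; rewrite -expr2 sqr_ge0. Qed.

Lemma norm2_ge0 u : 0 <= norm2 u.
Proof. exact: sqrtr_ge0. Qed.

Lemma norm2_sqr u : norm2 u ^+ 2 = dotv u u.
Proof. by rewrite sqr_sqrtr ?dotv_ge0. Qed.

(** Cauchy-Schwarz. With [a = |u|] and [b = |v|], expanding [|b u - a v|^2 >= 0] gives
    [a b (a b - <u, v>) >= 0]; the factor [a b] cancels unless it is zero, a case treated on its
    own. *)
Lemma dotv_le_norm2 u v : dotv u v <= norm2 u * norm2 v.
Proof.
have a0 := norm2_ge0 u; have b0 := norm2_ge0 v.
have := dotv_ge0 (norm2 v *: u - norm2 u *: v).
rewrite !dotvE (dotvC v u) -!norm2_sqr.
move: a0 b0; set a := norm2 u; set b := norm2 v => a0 b0 H.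
have H2 : 0 <= (a * b) * (a * b - dotv u v) by lra.
have [ab0|ab0] := eqVneq (a * b) 0; last first.
  by move: H2; rewrite pmulr_rge0 ?subr_ge0 // lt_def ab0 mulr_ge0.
rewrite ab0 leNgt; apply/negP => d0.
(* One vector has norm zero, so [|v - k u|^2] is affine in [k] and cannot stay nonnegative. *)
have Hk k := dotv_ge0 (u - k *: v).
have Hl k := dotv_ge0 (v - k *: u).
move/eqP: ab0; rewrite mulf_eq0 => /orP[] /eqP ab0.
  have uu : dotv u u = 0 by rewrite -norm2_sqr -/a ab0 expr0n.
  have := Hl ((dotv v v + 1) / dotv u v).
  rewrite !dotvE (dotvC v u) uu !(mulr0, mulrN, oppr0, addr0) mulfVK ?gt_eqF //.
  have := dotv_ge0 v; lra.
have vv : dotv v v = 0 by rewrite -norm2_sqr -/b ab0 expr0n.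
have := Hk ((dotv u u + 1) / dotv u v).
rewrite !dotvE (dotvC v u) vv !(mulr0, mulrN, oppr0, addr0) mulfVK ?gt_eqF //.
have := dotv_ge0 u; lra.
Qed.

Lemma norm20 : norm2 (0 : 'rV[R]_n) = 0.
Proof. by rewrite /norm2 -(scale0r 0) dotvZl mul0r sqrtr0. Qed.

Lemma norm2N u : norm2 (- u) = norm2 u.
Proof. by rewrite /norm2 dotvNl dotvNr opprK. Qed.

Lemma norm2B u v : norm2 (u - v) = norm2 (v - u).
Proof. by rewrite -norm2N opprB. Qed.

Lemma norm2Z a u : norm2 (a *: u) = `|a| * norm2 u.
Proof. by rewrite /norm2 dotvZl dotvZr mulrA -expr2 sqrtrM ?sqr_ge0 // sqrtr_sqr. Qed.

Lemma norm2D u v : norm2 (u + v) <= norm2 u + norm2 v.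
Proof.
rewrite -ler_sqr ?nnegrE ?addr_ge0 ?norm2_ge0 // norm2_sqr.
rewrite !dotvE (dotvC v u) -!norm2_sqr.
have := dotv_le_norm2 u v; lra.
Qed.

Lemma coord_le_norm2 u i : `|u 0 i| <= norm2 u.
Proof.
rewrite -ler_sqr ?nnegrE ?norm2_ge0 // norm2_sqr real_normK ?num_real //.
rewrite /dotv (bigD1 i) //= -expr2 lerDl.
by apply: sumr_ge0 => j _; rewrite -expr2 sqr_ge0.
Qed.

Lemma dotv_continuous u : continuous (dotv u).
Proof.
apply: (@continuous_sumr _ _ _ (fun i v => u 0 i * v 0 i)) => i v.
apply: (@cvgM _ _ (nbhs v)); [exact: cvg_cst|exact: coord_continuous].
Qed.

Lemma norm2B_sqr_continuous w : continuous (fun v => norm2 (v - w) ^+ 2).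
Proof.
have -> : (fun v => norm2 (v - w) ^+ 2) =
    (fun v => \sum_(i < n) (v 0 i - w 0 i) * (v 0 i - w 0 i)).
  by apply/funext => v; rewrite norm2_sqr; apply: eq_bigr => i _; rewrite !mxE.
apply: (@continuous_sumr _ _ _ (fun i v => (v 0 i - w 0 i) * (v 0 i - w 0 i))) => i v.
by apply: (@cvgM _ _ (nbhs v)); apply: (@cvgB _ _ _ (nbhs v));
  [exact: coord_continuous|exact: cvg_cst|
  exact: coord_continuous|exact: cvg_cst].
Qed.

(** The library norm on row vectors is the largest coordinate in absolute value, hence at most
    [norm2]. This passes from Euclidean bounds to the compactness criterion. *)
Lemma ebounded_bounded (A : set 'rV[R]_n) : ebounded A -> bounded_set A.
Proof.
move=> [B AB]; exists (Num.max B 0); split; first exact: num_real.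
move=> M BM u /AB uB; rewrite /Num.norm /= mx_normrE.
apply/bigmax_leP; split => [|i _]; first by move: BM; rewrite gt_max => /andP[_ /ltW].
rewrite ord1; apply: le_trans (coord_le_norm2 _ _) _; apply: le_trans uB _.
by move: BM; rewrite gt_max => /andP[/ltW].
Qed.

End EuclideanStructure.

(** * First-order inequalities along segments *)

Section DirectionalDerivatives.
Context {R : realType} {n : nat}.
Implicit Types (h : 'rV[R]_n -> R) (a b v : 'rV[R]_n).

(** The derivative is the limit of the quotients from the right alone. Only small [s > 0] are tested
    because at a boundary point of a domain the opposite direction may leave it. *)
Lemma diff_dir_le h a v (C e : R) : 0 < e -> differentiable h a ->
  (forall s, 0 < s < e -> h (a + s *: v) - h a <= C * s) -> 'd h a v <= C.
Proof.
move=> e0 dh hC; rewrite -deriveE //.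
have dv := @diff_derivable _ _ _ h a v dh.
have cv : (s^-1 *: ((h \o shift a) (s *: v) - h a)) @[s --> 0^'+] --> 'D_v h a.
  exact: cvg_dnbhs_at_right.
rewrite -(cvg_lim _ cv) //; apply: limr_le; first by apply/cvg_ex; eexists; exact: cv.
near=> s; have s0 : 0 < s by near: s; exact: nbhs_right_gt.
rewrite /= -[_ *: _]/(_ * _) mulrC ler_pdivrMr // [X in h X]addrC; apply: hC; rewrite s0 /=.
by near: s; exact: nbhs_right_lt.
Unshelve. all: by end_near. Qed.

Lemma convex_diff_le h a b : differentiable h a ->
  (forall t, 0 < t < 1 -> h (t *: b + (1 - t) *: a) <= t * h b + (1 - t) * h a) ->
  h a + 'd h a (b - a) <= h b.
Proof.
move=> dh hh; rewrite addrC -lerBrDr; apply: (@diff_dir_le _ _ _ _ 1) => // s s01.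
have -> : a + s *: (b - a) = s *: b + (1 - s) *: a.
  by rewrite scalerBr scalerBl scale1r addrCA addrA.
have := hh s s01; lra.
Qed.

Lemma segment_diff_le h a b (C : R) :
  (forall t, 0 <= t <= 1 -> differentiable h (t *: b + (1 - t) *: a)) ->
  (forall t, 0 <= t <= 1 -> 'd h (t *: b + (1 - t) *: a) (b - a) <= C) ->
  h b - h a <= C.
Proof.
move=> dh hC.
pose k (t : R) := h (t *: b + (1 - t) *: a).
have dk (t : R) : 0 <= t <= 1 -> is_derive t 1 k ('d h (t *: b + (1 - t) *: a) (b - a)).
  move=> /dh dkt.
  (* The quotients of [k] in direction [1] are literally those of [h] in direction [b - a], so no
     chain rule is involved. *)
  have kE : (fun s => s^-1 *: ((k \o shift t) (s *: 1) - k t)) =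
      (fun s => s^-1 *: ((h \o shift (t *: b + (1 - t) *: a)) (s *: (b - a))
                         - h (t *: b + (1 - t) *: a))).
    apply/funext => s; congr (_ *: (h _ - _)).
    apply/rowP => i; rewrite !mxE /= -[s *: 1]/(s * 1); ring.
  apply: DeriveDef; first by rewrite /derivable kE; exact: diff_derivable.
  by rewrite /derive kE -deriveE.
have [||c c01] := @MVT_segment R k (fun t => 'd h (t *: b + (1 - t) *: a) (b - a)) 0 1 ler01.
- by move=> t; rewrite in_itv /= => /andP[/ltW ? /ltW ?]; apply: dk; apply/andP.
- apply: derivable_within_continuous => t; rewrite in_itv /= => t01.
  by have := dk t t01 => -[].
- rewrite /k scale1r subrr scale0r addr0 scale0r subr0 scale1r add0r mulr1 => ->.
  by apply: hC; move: c01; rewrite in_itv.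
Qed.
End DirectionalDerivatives.

(** * Real-valued convexity on a domain: prox inequality and Jensen *)

Section RealConvexity.
Context {R : realType} {n : nat}.
Implicit Types (D : set 'rV[R]_n) (F : 'rV[R]_n -> R) (v : nat -> 'rV[R]_n).

Definition convex_on D F := forall a b (t : R), D a -> D b -> 0 < t < 1 ->
  D (t *: a + (1 - t) *: b) /\ F (t *: a + (1 - t) *: b) <= t * F a + (1 - t) * F b.

Lemma ler0_of_linear_bound (a b : R) : (forall t, 0 < t < 1 -> a <= b * t) -> a <= 0.
Proof.
move=> H; rewrite leNgt; apply/negP => a0.
have b0 : 0 < b by have := H (1/2); lra.
have s0 : 0 < a + b + b by lra.
(* One explicit small [t = a / (a + 2 b)] replaces the limit [t -> 0]: it would give
   [a (a + 2 b) <= a b]. *)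
have /H : 0 < a / (a + b + b) < 1 by rewrite divr_gt0 // ltr_pdivrMr //; lra.
rewrite mulrA ler_pdivlMr //; nra.
Qed.

(** The minimizer [x] is compared with [x + t (u - x)]. After expanding the square and dividing by
    [t], the only term still depending on [t] is [t |u - x|^2 / 2], which vanishes as [t -> 0]. *)
Lemma prox_variational D F lam (w x u : 'rV[R]_n) : 0 < lam -> convex_on D F ->
  D x -> D u ->
  (forall u, D u -> F x + (2 * lam)^-1 * norm2 (x - w) ^+ 2
                    <= F u + (2 * lam)^-1 * norm2 (u - w) ^+ 2) ->
  lam * (F x - F u) <= dotv (x - w) (u - x).
Proof.
move=> lam0 cF Dx Du prox.
rewrite -subr_le0; apply: (@ler0_of_linear_bound _ (dotv (u - x) (u - x) / 2)) => t t01.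
have [Dt Ft] := cF _ _ _ Du Dx t01.
have := prox _ Dt.
have -> : t *: u + (1 - t) *: x - w = (x - w) + t *: (u - x).
  by apply/rowP => i; rewrite !mxE; ring.
rewrite !norm2_sqr (dotvDl (x - w)) !(dotvDr _ (x - w)) !dotvZl !dotvZr.
rewrite (dotvC (u - x) (x - w)).
move: Ft; set d := dotv (x - w) (u - x); set e := dotv (u - x) _.
set X := dotv _ _; set Ft := F (_ + _) => hF hp.
have l2 : 2 * lam * (2 * lam)^-1 = 1 by rewrite mulfV //; lra.
move: t01 => /andP[t0 t1].
have H : t * (F x - F u) <= (2 * lam)^-1 * (2 * t * d + t * t * e) by lra.
have {}H : t * (lam * (F x - F u)) <= t * (d + t * e / 2).
  have : 2 * lam * (t * (F x - F u)) <= 2 * lam * ((2 * lam)^-1 * (2 * t * d + t * t * e)).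
    by rewrite ler_pM2l //; lra.
  by rewrite (mulrA _ (2 * lam)^-1) l2 mul1r; lra.
move: H; rewrite ler_pM2l //; lra.
Qed.

Lemma psumr_weights_gt0 (tau : nat -> R) N : (forall k, 0 < tau k) -> (1 <= N)%N ->
  0 < \sum_(1 <= k < N.+1) tau k.
Proof.
move=> tau0 N1; rewrite big_nat_recr //= ltr_wpDl // sumr_ge0 // => k _.
exact: ltW.
Qed.

(** Jensen by induction: with [S] the old total weight and [t] the new one, the next average is the
    convex combination with coefficients [S / (S + t)] and [t / (S + t)] of the old average and the
    new point. *)
Lemma wavg_convex D F (tau : nat -> R) v N : (forall k, 0 < tau k) -> (forall k, D (v k)) ->
  convex_on D F -> (1 <= N)%N ->
  D (wavg tau v N) /\
  (\sum_(1 <= k < N.+1) tau k) * F (wavg tau v N) <= \sum_(1 <= k < N.+1) tau k * F (v k).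
Proof.
move=> tau0 Dv cF; elim: N => // -[_ _|N IH _].
  have E : wavg tau v 1 = v 1.
    by rewrite /wavg !big_nat1 scalerA mulVf ?scale1r // gt_eqF.
  by rewrite E !big_nat1.
have [DN FN] := IH isT.
have S0 := psumr_weights_gt0 tau0 (isT : (1 <= N.+1)%N).
have T0 := psumr_weights_gt0 tau0 (isT : (1 <= N.+2)%N).
move: DN FN S0 T0; rewrite /wavg ![\big[_/_]_(1 <= _ < N.+3) _]big_nat_recr //=.
set S := \sum_(1 <= k < N.+2) tau k; set V := \sum_(1 <= k < N.+2) tau k *: v k.
set t := tau N.+2 => DN FN S0 T0.
have St : 0 < S / (S + t) < 1.
  by rewrite divr_gt0 ?ltr_pdivrMr // mul1r ltrDl tau0.
have := cF _ _ _ DN (Dv N.+2) St.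
have eT : 1 - S / (S + t) = t / (S + t) by field; rewrite gt_eqF.
have -> : (S / (S + t)) *: (S^-1 *: V) + (1 - S / (S + t)) *: v N.+2 =
          (S + t)^-1 *: (V + t *: v N.+2).
  rewrite eT scalerDr !scalerA; congr (_ *: _ + _ *: _); last by rewrite mulrC.
  by field; rewrite !gt_eqF.
move=> [DD H]; split=> //.
apply: (@le_trans _ _ (S * F (S^-1 *: V) + t * F (v N.+2))); last by rewrite lerD2r.
apply: (@le_trans _ _
    ((S + t) * (S / (S + t) * F (S^-1 *: V) + (1 - S / (S + t)) * F (v N.+2)))).
  by rewrite ler_pM2l.
by rewrite eT le_eqVlt; apply/orP; left; apply/eqP; field; rewrite gt_eqF.
Qed.

End RealConvexity.

(** * Extended-valued functions, conjugates and existence of prox points *)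

Section ExtendedValued.
Context {R : realType} {n : nat}.
Implicit Types (h : 'rV[R]_n -> \bar R).

Lemma edom_fin h u : (forall u, h u != -oo%E) -> edom h u -> h u = (fine (h u))%:E.
Proof. by move=> hN; have := hN u; rewrite /edom /=; case: (h u). Qed.

Lemma convex_efun_fine h : (forall u, h u != -oo%E) -> convex_efun h ->
  convex_on (edom h) (fine \o h).
Proof.
move=> hN ch a b t Da Db t01; have := ch a b t t01; move: (Da) (Db).
rewrite (edom_fin hN Da) (edom_fin hN Db) -!EFinM -EFinD => _ _ H.
have D : edom h (t *: a + (1 - t) *: b) by apply: le_lt_trans H (ltry _).
by split => //; move: H; rewrite (edom_fin hN D) lee_fin.
Qed.

Lemma is_prox_edom h lam w x u0 : edom h u0 -> is_prox lam h w x -> edom h x.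
Proof.
rewrite /edom /= => Du0 /(_ u0) H; move: Du0 H; case: (h x) => // [r|].
  by rewrite ltry.
by case: (h u0).
Qed.

Lemma is_prox_variational h lam w x u : (forall u, h u != -oo%E) -> convex_efun h ->
  0 < lam -> edom h u -> is_prox lam h w x ->
  lam * (fine (h x) - fine (h u)) <= dotv (x - w) (u - x).
Proof.
move=> hN ch lam0 Du prox; have Dx := is_prox_edom Du prox.
apply: (@prox_variational _ _ (edom h) (fine \o h)) => //; first exact: convex_efun_fine.
move=> v Dv; have := prox v.
by rewrite (edom_fin hN Dx) (edom_fin hN Dv) -!EFinD lee_fin.
Qed.

Lemma fenchel_conj_neqNy h : proper_fun h -> forall y, fenchel_conj h y != -oo%E.
Proof.
move=> [hN [u0 Du0]] y; rewrite -ltNye.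
apply: (@lt_le_trans _ _ ((dotv y u0)%:E - h u0)%E).
  by rewrite (edom_fin hN Du0) -EFinB ltNyr.
by apply: ereal_sup_ubound; exists u0.
Qed.

Lemma convex_fenchel_conj h : proper_fun h -> convex_efun (fenchel_conj h).
Proof.
move=> ph a b t /andP[t0 t1]; have [hN _] := ph.
have fN := fenchel_conj_neqNy ph.
(* An infinite value on the right makes that side [+oo], since neither term can be [-oo]. What
   remains is a supremum of affine functions. *)
have [Da|Da] := ltP (fenchel_conj h a) +oo%E; last first.
  move: Da; rewrite leye_eq => /eqP ->; rewrite gt0_muley ?lte_fin // addye ?leey //.
  have [/(edom_fin fN) ->|] := ltP (fenchel_conj h b) +oo%E; first by rewrite -EFinM.
  by rewrite leye_eq => /eqP ->; rewrite gt0_muley // lte_fin subr_gt0.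
have [Db|Db] := ltP (fenchel_conj h b) +oo%E; last first.
  move: Db; rewrite leye_eq => /eqP ->; rewrite gt0_muley ?lte_fin ?subr_gt0 //.
  by rewrite (edom_fin fN Da) -EFinM addey ?leey.
apply: ge_ereal_sup => _ [u _ <-].
have [Du|Du] := ltP (h u) +oo%E; last first.
  by move: Du; rewrite leye_eq => /eqP -> /=; rewrite leNye.
have ub c : edom (fenchel_conj h) c -> dotv c u - fine (h u) <= fine (fenchel_conj h c).
  move=> Dc; rewrite -lee_fin -(edom_fin fN Dc) EFinB -(edom_fin hN Du).
  by apply: ereal_sup_ubound; exists u.
have Ha := ub a Da; have Hb := ub b Db.
rewrite (edom_fin fN Da) (edom_fin fN Db) (edom_fin hN Du) -!EFinM -!EFinD.
rewrite lee_fin /= dotvDl !dotvZl.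
have := ler_wpM2l (ltW t0) Ha; have t1' : 0 <= 1 - t by lra.
have := ler_wpM2l t1' Hb; lra.
Qed.

(** Coercivity of the prox objective: a point [u0] of the domain of [h] gives the affine minorant
    [<y, u0> - h u0], and half of the quadratic term absorbs its slope. *)
Lemma fenchel_conj_lower_bound h w (lam : R) : proper_fun h -> 0 < lam ->
  exists m : R, forall y, edom (fenchel_conj h) y ->
    m + norm2 (y - w) ^+ 2 / (4 * lam)
      <= fine (fenchel_conj h y) + norm2 (y - w) ^+ 2 / (2 * lam).
Proof.
move=> ph lam0; have [hN [u0 Du0]] := ph; have fN := fenchel_conj_neqNy ph.
exists (dotv w u0 - fine (h u0) - lam * dotv u0 u0) => y Dy.
have : dotv y u0 - fine (h u0) <= fine (fenchel_conj h y).
  rewrite -lee_fin -(edom_fin fN Dy) EFinB -(edom_fin hN Du0).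
  by apply: ereal_sup_ubound; exists u0.
(* Completing the square: this yields [- <y - w, u0> - lam |u0|^2 <= |y - w|^2 / (4 lam)]. *)
have := dotv_ge0 ((y - w) + (2 * lam) *: u0).
rewrite norm2_sqr; have du : dotv (y - w) u0 = dotv y u0 - dotv w u0.
  by rewrite !dotvE.
move: (y - w) du => d du.
rewrite !dotvE (dotvC u0 d) du; set e := dotv d d.
move=> H1 H2.
have E : e / (2 * lam) - e / (4 * lam) = e / (4 * lam).
  by field; rewrite gt_eqF.
suff : dotv w u0 - dotv y u0 - lam * dotv u0 u0 <= e / (4 * lam) by lra.
by rewrite ler_pdivlMr; lra.
Qed.

(** These are the sublevel sets of the conjugate plus [c |y - w|^2]. Each is an intersection, over
    [u] in the domain of [h], of sublevel sets of continuous real functions. *)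
Lemma closed_fenchel_sublevel h w (c m : R) : (forall u, h u != -oo%E) ->
  closed [set y | (fenchel_conj h y <= (m - c * norm2 (y - w) ^+ 2)%:E)%E].
Proof.
move=> hN.
have -> : [set y | (fenchel_conj h y <= (m - c * norm2 (y - w) ^+ 2)%:E)%E] =
    \bigcap_(u in edom h)
      (fun y => dotv u y + c * norm2 (y - w) ^+ 2) @^-1` [set r | r <= m + fine (h u)].
  apply/seteqP; split => y /=.
    move=> H u Du /=.
    have : (((dotv y u)%:E - h u) <= (m - c * norm2 (y - w) ^+ 2)%:E)%E.
      by apply: le_trans H; apply: ereal_sup_ubound; exists u.
    by rewrite (edom_fin hN Du) -EFinB lee_fin dotvC /=; lra.
  move=> H; apply: ge_ereal_sup => _ [u _ <-].
  have [Du|Du] := ltP (h u) +oo%E; last first.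
    by move: Du; rewrite leye_eq => /eqP -> /=; rewrite leNye.
  by have := H u Du; rewrite /= (edom_fin hN Du) -EFinB lee_fin dotvC /=; lra.
apply: closed_bigI => u _; apply: preimage_closed; last exact: closed_le.
move=> y _; apply: (@cvgD _ _ _ (nbhs y)); first exact: dotv_continuous.
by apply: (@cvgM _ _ (nbhs y)); [exact: cvg_cst|exact: norm2B_sqr_continuous].
Qed.

(* The sublevel sets of the prox objective are compact (closed as conjugates are suprema
   of affine functions, bounded by an affine minorant of the conjugate), so a
   minimizing sequence has a cluster point in all of them. *)
Lemma fenchel_prox_exists h w (lam : R) : proper_fun h ->
  (exists y, edom (fenchel_conj h) y) -> 0 < lam ->
  exists y, is_prox lam (fenchel_conj h) w y.
Proof.
move=> ph [y0 Dy0] lam0; have [hN _] := ph; have fN := fenchel_conj_neqNy ph.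
set c := (2 * lam)^-1.
pose obj y := fine (fenchel_conj h y) + c * norm2 (y - w) ^+ 2.
pose S := obj @` edom (fenchel_conj h).
have [m hm] := fenchel_conj_lower_bound w ph lam0.
have hmo y : edom (fenchel_conj h) y -> m + norm2 (y - w) ^+ 2 / (4 * lam) <= obj y.
  by move=> Dy; rewrite /obj [c * _]mulrC; exact: hm.
have pos y : 0 <= norm2 (y - w) ^+ 2 / (4 * lam).
  by rewrite divr_ge0 ?sqr_ge0 //; lra.
have Sinf : has_inf S.
  split; first by exists (obj y0); exists y0.
  by exists m => _ [y Dy <-]; have := hmo _ Dy; have := pos y; lra.
have lbS y : edom (fenchel_conj h) y -> inf S <= obj y.
  by move=> Dy; apply: ge_inf; [case: Sinf|exists y].
pose K (e : R) := [set y | (fenchel_conj h y <= (inf S + e - c * norm2 (y - w) ^+ 2)%:E)%E].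
have KP e y : K e y <-> edom (fenchel_conj h) y /\ obj y <= inf S + e.
  rewrite /K /=; split => [H|[Dy]].
    have Dy : edom (fenchel_conj h) y by apply: le_lt_trans H (ltry _).
    by split => //; move: H; rewrite (edom_fin fN Dy) lee_fin /obj; lra.
  by rewrite (edom_fin fN Dy) lee_fin /obj; lra.
have Kcl e : closed (K e) by exact: closed_fenchel_sublevel.
have ex k : exists y, K k.+1%:R^-1 y.
  have k0 : 0 < k.+1%:R^-1 :> R by rewrite invr_gt0.
  have [_ [y Dy <-] H] := inf_adherent k0 Sinf.
  by exists y; apply/KP; split => //; exact: ltW.
pose s k := projT1 (cid (ex k)).
have Ks k : K k.+1%:R^-1 (s k) by rewrite /s; case: cid.
have Kmono e e' : e <= e' -> K e `<=` K e'.
  by move=> ee' y /KP[Dy H]; apply/KP; split => //; lra.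
have K1 : compact (K 1).
  apply: bounded_closed_compact => //; apply: ebounded_bounded.
  exists (norm2 w + (inf S + 1 - m) * (4 * lam) + 1) => y /KP[Dy H].
  have H2 : norm2 (y - w) ^+ 2 / (4 * lam) <= inf S + 1 - m by have := hmo _ Dy; lra.
  have {}H2 : norm2 (y - w) ^+ 2 <= (inf S + 1 - m) * (4 * lam).
    by rewrite -ler_pdivrMr //; lra.
  have : norm2 y <= norm2 (y - w) + norm2 w.
    by have := norm2D (y - w) w; rewrite subrK.
  by have := norm2_ge0 (y - w); nra.
have [y [_ cly]] : K 1 `&` cluster (s @ \oo) !=set0.
  apply: K1; exists 0 => // k _ /=.
  by apply: (Kmono k.+1%:R^-1); [rewrite invf_le1 // ler1n|exact: Ks].
have Ky k : K k.+1%:R^-1 y.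
  have /closure_id -> := Kcl k.+1%:R^-1.
  move: cly; rewrite clusterE; apply; exists k => // j /= kj.
  by apply: Kmono (Ks j); rewrite lef_pV2 ?posrE // ler_nat ltnS.
have Dy : edom (fenchel_conj h) y by have /KP[] := Ky 0.
have oy : obj y <= inf S.
  apply/ler_addgt0Pr => e e0.
  have [k _ /(_ k (leqnn _)) ke] := near_infty_natSinv_lt (PosNum e0).
  by have /KP[_ H] := Ky k; apply: le_trans H _; rewrite lerD2l ltW.
exists y => u; have [Du|Du] := ltP (fenchel_conj h u) +oo%E; last first.
  by move: Du; rewrite leye_eq => /eqP ->; rewrite addye ?leey.
rewrite (edom_fin fN Dy) (edom_fin fN Du) -!EFinD lee_fin -/c.
exact: le_trans oy (lbS _ Du).
Qed.

End ExtendedValued.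

(** * Sums of the nonmonotone window averages *)

Section WindowAverages.
Context {R : realType}.
Variables (eta : R) (M : nat) (r : nat -> R).
Hypotheses (eta01 : 0 <= eta < 1) (M1 : (1 <= M)%N) (r0 : forall k, 0 <= r k).

Lemma c_seq_ge0 n : 0 <= c_seq eta M r n.
Proof.
rewrite /c_seq; case: ifP => // _; have /andP[e0 _] := eta01.
by rewrite mulr_ge0 ?divr_ge0 ?sumr_ge0.
Qed.

Lemma sumr_shift_le j a b :
  (1 <= a)%N -> \sum_(a <= i < b) r (i + j) <= \sum_(1 <= k < b + j) r k.
Proof.
move=> a1; have -> : \sum_(a <= i < b) r (i + j) = \sum_(a + j <= k < b + j) r k.
  by rewrite big_addn addnK.
have [ba|ab] := leqP (b + j) (a + j); first by rewrite big_geq // sumr_ge0.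
rewrite [leRHS](big_cat_nat (n := (a + j))) /=; [|lia|lia].
by rewrite lerDr sumr_ge0.
Qed.

(** Once [n > M] the window is full. Indexing it by a fixed range of offsets [j < M] makes the
    double sum exchangeable. *)
Lemma c_seqE n : (M < n)%N -> c_seq eta M r n = eta / M%:R * \sum_(j < M) r (n - M + j).
Proof.
move=> Mn; rewrite /c_seq; have -> : (n <= 1)%N = false by lia.
have -> : maxn (n - M) 1 = (n - M)%N by lia.
rewrite subKn; last exact: ltnW.
congr (_ * _); rewrite -{1}[(n - M)%N]add0n big_addn subKn; last exact: ltnW.
by rewrite big_mkord; apply: eq_bigr => i _; rewrite addnC.
Qed.

(** For each offset [j] the terms [r (n - M + j)] form a shifted part of the sum of [r]. There are
    [M] offsets of weight [eta / M], hence total weight [eta <= 1]; the first [M] averages stay as a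
    constant. *)
Lemma c_seq_sum_le N :
  \sum_(1 <= n < N.+1) c_seq eta M r n
    <= \sum_(1 <= n < M.+1) c_seq eta M r n + \sum_(1 <= n < N.+1) r n.
Proof.
have cs_ge0 a b : 0 <= \sum_(a <= n < b) c_seq eta M r n.
  by apply: sumr_ge0 => k _; exact: c_seq_ge0.
have [NM|MN] := leqP N M.
  rewrite [X in _ <= X + _](big_cat_nat (n := N.+1)) /=; [|lia|lia].
  rewrite -addrA lerDl addr_ge0 //; exact: sumr_ge0.
rewrite [leLHS](big_cat_nat (n := M.+1)) /=; [|lia|lia].
rewrite lerD2l.
have M0 : 0 < M%:R :> R by rewrite ltr0n.
have -> : \sum_(M.+1 <= n < N.+1) c_seq eta M r n =
    eta / M%:R * \sum_(j < M) \sum_(M.+1 <= n < N.+1) r (n - M + j).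
  rewrite exchange_big /= mulr_sumr; apply: eq_big_nat => n /andP[Mn _].
  exact: c_seqE.
have S0 : 0 <= \sum_(1 <= n < N.+1) r n by exact: sumr_ge0.
apply: (@le_trans _ _ (eta / M%:R * \sum_(j < M) \sum_(1 <= n < N.+1) r n)).
  rewrite ler_wpM2l ?divr_ge0 ?(ltW M0) //; first by case/andP: eta01.
  apply: ler_sum => j _.
  rewrite -add1n big_addn.
  under eq_bigr do rewrite addnK.
  apply: le_trans (sumr_shift_le _ _ _) _ => //.
  rewrite [leRHS](big_cat_nat (n := (N.+1 - M + j))) /=; [|lia|have := ltn_ord j; lia].
  by rewrite lerDl sumr_ge0.
rewrite sumr_const card_ord -[X in _ * X]mulr_natl mulrA divfK ?gt_eqF //.
by rewrite ler_piMl //; have := eta01; lra.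
Qed.

End WindowAverages.

(** * One-step primal and dual inequalities *)

Section StepInequalities.
Context {R : realType} {n : nat}.

(** Two prox inequalities are combined: the one for [x1] tested at [xs], and the one for [xn] tested
    at [x1] and scaled by [tn / tp]. In [omega_of], [2 psi] comes from the second, [xi] from Young's
    inequality, and the last term from completing a square in [x1 - z1] and [x1 - xn]. *)
Lemma primal_step (psi xi phi tn tp gs gn g1 : R)
    (xs xn x1 zn z1 z2 Gn Gp : 'rV[R]_n) :
  1 < psi -> 0 < xi -> 0 < tn -> 0 < tp -> tn <= phi * tp ->
  z1 = ((psi - 1) / psi) *: xn + psi^-1 *: zn ->
  z2 = ((psi - 1) / psi) *: x1 + psi^-1 *: z1 ->
  tn * (g1 - gs) <= dotv (x1 - (z1 - tn *: Gn)) (xs - x1) ->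
  tp * (gn - g1) <= dotv (xn - (zn - tp *: Gp)) (x1 - xn) ->
  2 * tn * (gn - gs) + psi / (psi - 1) * norm2 (z2 - xs) ^+ 2
    + omega_of psi xi phi * (tn / tp) * norm2 (x1 - xn) ^+ 2
  <= psi / (psi - 1) * norm2 (z1 - xs) ^+ 2 + 2 * tn * dotv Gn (xs - xn)
     + tn * tp / xi * norm2 (Gn - Gp) ^+ 2.
Proof.
move=> psi1 xi0 tn0 tp0 tnp Ez1 Ez2.
have psiN0 : psi != 0 by rewrite gt_eqF //; lra.
have psi1N0 : psi - 1 != 0 by rewrite gt_eqF //; lra.
pose P := z1 - xs; pose a := x1 - z1; pose c := x1 - xn.
have -> : z2 - xs = ((psi - 1) / psi) *: a + P.
  by rewrite Ez2; apply/rowP => i; rewrite !mxE; field.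
have -> : x1 - (z1 - tn *: Gn) = a + tn *: Gn.
  by apply/rowP => i; rewrite !mxE; ring.
have -> : xs - x1 = - (a + P) by apply/rowP => i; rewrite !mxE; ring.
have -> : xs - xn = c - a - P by apply/rowP => i; rewrite !mxE; ring.
(* Eliminating [zn] by the recursion gives [xn - zn = psi (xn - z1)]. *)
have -> : xn - (zn - tp *: Gp) = psi *: (a - c) + tp *: Gp.
  by apply/rowP => i; rewrite /a Ez1 !mxE; field.
rewrite -/P -/c; move: P a c => P a c; clear Ez1 Ez2.
have Young := dotv_ge0 (tp *: (Gn - Gp) + xi *: c).
(* The weights are chosen so that, divided by [psi (1 + psi)], the square has the coefficient
   [1 + 1 / psi] of [|a|^2] and the cross term [- 2 psi d <a, c>] left by the prox inequalities,
   where [d = tn / tp]. *)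
have Q := dotv_ge0 ((1 + psi) *: a - (psi ^+ 2 * (tn / tp)) *: c).
have dE : tn = tn / tp * tp by rewrite divfK // gt_eqF.
have dphi : tn / tp <= phi by rewrite ler_pdivrMr.
have d0 : 0 < tn / tp by rewrite divr_gt0.
move: (tn / tp) dE dphi d0 Q => d dE dphi d0 Q {tnp}.
rewrite !norm2_sqr.
move: Young Q; rewrite !dotvE.
rewrite (dotvC c a) (dotvC c Gn) (dotvC c Gp) (dotvC Gp Gn) (dotvC P a).
have cc0 := dotv_ge0 c.
move: (dotv a a) (dotv a c) (dotv c c) cc0 (dotv a P) (dotv P P) (dotv Gn c)
  (dotv Gp c) (dotv Gn a) (dotv Gn P) (dotv Gn Gn) (dotv Gn Gp) (dotv Gp Gp).
move=> aa ac cc cc0 aP PP Gnc Gpc Gna GnP GnGn GnGp GpGp Young Q h1 h2.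
have {}h2 : d * (tp * (gn - g1)) <= d * (psi * (ac - cc) + tp * Gpc).
  by rewrite ler_pM2l //; lra.
have {}Young : 0 <= d / xi * (tp * (tp * (GnGn - GnGp) + xi * Gnc - (tp * (GnGp - GpGp)
    + xi * Gpc)) + xi * (tp * (Gnc - Gpc) + xi * cc)).
  by rewrite mulr_ge0 ?divr_ge0 ?(ltW d0) ?(ltW xi0).
have {}Young : 0 <= tn * tp / xi * (GnGn - GnGp - (GnGp - GpGp))
    + 2 * tn * (Gnc - Gpc) + xi * d * cc.
  apply: le_trans Young _; rewrite le_eqVlt; apply/orP; left; apply/eqP.
  by rewrite dE; field; rewrite gt_eqF.
have {}Q : 0 <= (1 + psi^-1) * aa - 2 * psi * d * ac + psi ^+ 3 / (1 + psi) * (d * d) * cc.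
  have k0 : 0 < (psi * (1 + psi))^-1 by rewrite invr_gt0 mulr_gt0 //; lra.
  apply: le_trans (mulr_ge0 (ltW k0) Q) _; rewrite le_eqVlt; apply/orP; left; apply/eqP.
  by field; rewrite psiN0 gt_eqF //; lra.
(* Here [d <= phi] turns [d^2] into [phi d], the form in which [omega_of] contains it. *)
have dd : psi ^+ 3 / (1 + psi) * (d * d) * cc <= psi ^+ 3 / (1 + psi) * (phi * d) * cc.
  rewrite ler_wpM2r // ler_wpM2l ?ler_pM2r //.
  by rewrite divr_ge0 ?exprn_ge0 //; lra.
have Ez : psi / (psi - 1) * ((psi - 1) / psi * ((psi - 1) / psi * aa + aP)
    + ((psi - 1) / psi * aP + PP)) = (1 - psi^-1) * aa + 2 * aP + psi / (psi - 1) * PP.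
  by field; rewrite psi1N0 psiN0.
rewrite Ez /omega_of.
have Ew : psi ^+ 3 * phi / (1 + psi) * d * cc = psi ^+ 3 / (1 + psi) * (phi * d) * cc.
  by ring.
move: (psi^-1) Q Ez Ew dd Young h2 => ip Q _ Ew dd Young h2.
have h2' : d * (tp * (gn - g1)) = tn * (gn - g1) by rewrite mulrA -dE.
have h2'' : d * (tp * Gpc) = tn * Gpc by rewrite mulrA -dE.
rewrite h2' (mulrDr d) h2'' in h2.
move: (psi ^+ 3 / (1 + psi)) (psi ^+ 3 * phi / (1 + psi)) (tn * tp / xi)
  (psi / (psi - 1)) Q dd Ew Young h1 h2 => k1 k2 k3 k4 Q dd Ew Young h1 h2.
lra.
Qed.

(** The prox inequality for [yn] tested at [ys], with its inner product rewritten by the three-point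
    identity. *)
Lemma dual_step (beta tn fs fn : R) (ys yn yp D : 'rV[R]_n) :
  0 < beta -> 0 < tn ->
  beta * tn * (fn - fs) <= dotv (yn - (yp + (beta * tn) *: D)) (ys - yn) ->
  2 * tn * (fn - fs) + beta^-1 * norm2 (yn - ys) ^+ 2
  <= beta^-1 * norm2 (yp - ys) ^+ 2 - beta^-1 * norm2 (yn - yp) ^+ 2
     - 2 * tn * dotv D (ys - yn).
Proof.
move=> b0 tn0 H.
have -> : norm2 (yp - ys) ^+ 2 =
    norm2 (yn - yp) ^+ 2 + norm2 (yn - ys) ^+ 2 + 2 * dotv (yn - yp) (ys - yn).
  by rewrite !norm2_sqr !dotvE (dotvC ys yn) (dotvC yp yn) (dotvC ys yp); ring.
have {}H : beta^-1 * (beta * tn * (fn - fs)) <=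
    beta^-1 * (dotv (yn - yp) (ys - yn) - beta * tn * dotv D (ys - yn)).
  rewrite ler_pM2l ?invr_gt0 //; apply: le_trans H _.
  by rewrite opprD addrA (dotvDl (yn - yp)) dotvNl dotvZl.
have e u : beta^-1 * (beta * tn * u) = tn * u by rewrite -mulrA mulKf // gt_eqF.
by move: H; rewrite (mulrBr beta^-1) !e; lra.
Qed.

End StepInequalities.

(** * The convex-concave coupling and its partial gradients *)

Section PDAcL.
Context {R : realType} {p q : nat}.
Variables (f : 'rV[R]_p -> \bar R) (g : 'rV[R]_q -> \bar R).
Variables (Phi : 'rV[R]_q -> 'rV[R]_p -> R).
Variables (gx : 'rV[R]_q -> 'rV[R]_p -> 'rV[R]_q).
Variables (gy : 'rV[R]_q -> 'rV[R]_p -> 'rV[R]_p).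
Hypotheses (hf : proper_closed_convex f) (hg : proper_closed_convex g).
Local Notation DX := (edom g).
Local Notation DY := (edom (fenchel_conj f)).
Local Notation G := (fine \o g).
Local Notation F := (fine \o fenchel_conj f).
Hypothesis hPhi_x : forall y, edom (fenchel_conj f) y ->
     (forall a b (t : R), edom g a -> edom g b -> 0 < t < 1 ->
        Phi (t *: a + (1 - t) *: b) y <= t * Phi a y + (1 - t) * Phi b y) /\
     (forall x, edom g x ->
        differentiable (fun u => Phi u y) x /\
        forall h, 'd (fun u => Phi u y) x h = dotv (gx x y) h).
Hypothesis hPhi_y : forall x, edom g x ->
     (forall a b (t : R), edom (fenchel_conj f) a -> edom (fenchel_conj f) b ->
        0 < t < 1 ->
        t * Phi x a + (1 - t) * Phi x b <= Phi x (t *: a + (1 - t) *: b)) /\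
     (forall y, edom (fenchel_conj f) y ->
        differentiable (fun v => Phi x v) y /\
        forall h, 'd (fun v => Phi x v) y h = dotv (gy x y) h).

Let gN : forall u, g u != -oo%E. Proof. by case: hg => -[]. Qed.
Let pf : proper_fun f. Proof. by case: hf. Qed.
Let fN : forall v, fenchel_conj f v != -oo%E. Proof. exact: fenchel_conj_neqNy. Qed.
Let cg : convex_efun g. Proof. by case: hg. Qed.
Let cf : convex_efun (fenchel_conj f). Proof. exact: convex_fenchel_conj. Qed.
Let cG : convex_on DX G. Proof. exact: convex_efun_fine. Qed.
Let cF : convex_on DY F. Proof. exact: convex_efun_fine. Qed.

Lemma grad_x_le y a b : DY y -> DX a -> DX b ->
  Phi a y + dotv (gx a y) (b - a) <= Phi b y.
Proof.
move=> Dy Da Db; have [c d] := hPhi_x Dy; have [da <-] := d _ Da.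
by apply: (convex_diff_le da) => t t01; exact: c.
Qed.

Lemma grad_y_ge x a b : DX x -> DY a -> DY b ->
  Phi x b <= Phi x a + dotv (gy x a) (b - a).
Proof.
move=> Dx Da Db; have [c d] := hPhi_y Dx; have [da dE] := d _ Da.
have dN : differentiable (fun v => - Phi x v) a by exact: differentiableN.
have := convex_diff_le (b := b) dN.
rewrite (_ : 'd _ _ _ = - dotv (gy x a) (b - a)); last first.
  by rewrite (diffN da) /= -dE.
move=> H; have := H _; rewrite -opprD lerN2; apply => t t01.
by have := c _ _ t Db Da t01; lra.
Qed.

Lemma convex_on_Phi_x ys : DY ys -> convex_on DX (fun x => G x + Phi x ys).
Proof.
move=> Dys a b t Da Db t01; have [D H] := cG Da Db t01; split => //.
by have := (hPhi_x Dys).1 a b t Da Db t01; move: H => /=; lra.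
Qed.

Lemma convex_on_Phi_y xs : DX xs -> convex_on DY (fun y => F y - Phi xs y).
Proof.
move=> Dxs a b t Da Db t01; have [D H] := cF Da Db t01; split => //.
by have := (hPhi_y Dxs).1 a b t Da Db t01; move: H => /=; lra.
Qed.

(* [gy] is only assumed Lipschitz in [y]; its variation in [x] is controlled along
   feasible directions by the mixed difference of [Phi], hence by [gx] in [y]. *)
Lemma gy_diff_le (Lxy B : R) xs ys x y : 0 <= Lxy -> DX xs -> DY ys -> DX x -> DY y ->
  (forall u v v', DX u -> norm2 u <= B -> DY v -> norm2 (v - ys) <= 1 ->
     DY v' -> norm2 (v' - ys) <= 1 ->
     norm2 (gx u v - gx u v') <= Lxy * norm2 (v - v')) ->
  norm2 xs <= B -> norm2 x <= B ->
  dotv (gy x ys - gy xs ys) (y - ys) <= Lxy * norm2 (y - ys) * norm2 (x - xs).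
Proof.
move=> L0 Dxs Dys Dx Dy Lip xsB xB.
pose k v := Phi x v - Phi xs v.
have [d1 E1] := (hPhi_y Dx).2 _ Dys; have [d2 E2] := (hPhi_y Dxs).2 _ Dys.
have dk : differentiable k ys by exact: differentiableB.
have -> : dotv (gy x ys - gy xs ys) (y - ys) = 'd k ys (y - ys).
  by rewrite (diffB d1 d2) dotvDl dotvNl -E1 -E2.
have n0 := norm2_ge0 (y - ys).
(* This range of [s] keeps [s < 1], so the moved point stays in the domain, and [s |y - ys| <= 1],
   so the Lipschitz hypothesis near [ys] applies. *)
apply: (@diff_dir_le _ _ _ _ _ _ (1 + norm2 (y - ys))^-1) => //.
  by rewrite invr_gt0; lra.
move=> s /andP[s0 s1].
have {}s1 : s * (1 + norm2 (y - ys)) < 1.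
  by rewrite -ltr_pdivlMr ?div1r //; lra.
have s01 : 0 < s < 1 by rewrite s0 /=; nra.
have sn : s * norm2 (y - ys) <= 1 by nra.
have e : ys + s *: (y - ys) = s *: y + (1 - s) *: ys.
  by apply/rowP => i; rewrite !mxE; ring.
set v := ys + s *: (y - ys).
have Dv : DY v by rewrite /v e; exact: (cF Dy Dys s01).1.
have nv : norm2 (v - ys) = s * norm2 (y - ys).
  by rewrite /v addrC addKr norm2Z gtr0_norm.
(* The mixed difference is regrouped: an increment of [k] in [y] is an increment of [m] in [x], to
   which the mean value inequality from [xs] to [x] applies. *)
pose m u := Phi u v - Phi u ys.
have mE : k v - k ys = m x - m xs by rewrite /k /m; ring.
have seg t : 0 <= t <= 1 -> DX (t *: x + (1 - t) *: xs) /\ norm2 (t *: x + (1 - t) *: xs) <= B.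
  move=> /andP[t0 t1]; split.
    move: t0; rewrite le_eqVlt => /orP[/eqP <-|t0].
      by rewrite scale0r add0r subr0 scale1r.
    move: t1; rewrite le_eqVlt => /orP[/eqP ->|t1].
      by rewrite subrr scale0r addr0 scale1r.
    by apply: (cG Dx Dxs _).1; rewrite t0.
  apply: le_trans (norm2D _ _) _; rewrite !norm2Z !ger0_norm ?subr_ge0 //.
  by nra.
rewrite mE; apply: segment_diff_le => t /seg[Du uB].
  have [+ _] := (hPhi_x Dv).2 _ Du; have [+ _] := (hPhi_x Dys).2 _ Du.
  by move=> ? ?; exact: differentiableB.
have [dv Ev] := (hPhi_x Dv).2 _ Du; have [dys Eys] := (hPhi_x Dys).2 _ Du.
rewrite (diffB dv dys) /= Ev Eys.
rewrite -dotvNl -dotvDl; apply: le_trans (dotv_le_norm2 _ _) _.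
rewrite mulrAC ler_wpM2r ?norm2_ge0 //.
have := Lip _ v ys Du uB Dv _ Dys _; rewrite nv subrr.
rewrite norm20.
move=> /(_ sn ler01); lra.
Qed.

(** * A run of the algorithm: domains and elementary step bounds *)

Hypothesis hLip : forall (X : set 'rV[R]_q) (Y : set 'rV[R]_p), ebounded X -> ebounded Y ->
     exists Lyy Lxx Lxy : R, [/\ 0 <= Lyy, 0 <= Lxx, 0 < Lxy,
       (forall x y y', X x -> edom g x -> Y y -> edom (fenchel_conj f) y ->
          Y y' -> edom (fenchel_conj f) y' ->
          norm2 (gy x y - gy x y') <= Lyy * norm2 (y - y')) &
       (forall x x' y y', X x -> edom g x -> X x' -> edom g x' ->
          Y y -> edom (fenchel_conj f) y -> Y y' -> edom (fenchel_conj f) y' ->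
          norm2 (gx x y - gx x' y') <= Lxx * norm2 (x - x') + Lxy * norm2 (y - y'))].
Variables (xs : 'rV[R]_q) (ys : 'rV[R]_p).
Hypothesis hOmega : in_Omega g f gx gy xs ys.
Variables (psi xi phi tau_max nu mu eta beta : R) (M : nat).
Hypotheses (hpsi : 1 < psi) (hxi : 0 < xi) (hphi : 1 < phi).
Hypotheses (homega : 0 < omega_of psi xi phi) (htau_max : 0 < tau_max).
Hypotheses (hnu : 0 < nu < 1) (hmu : 0 < mu < 1) (heta : 0 <= eta < 1).
Hypotheses (hM : (1 <= M)%N) (hbeta : 0 < beta).
Variables (x z : nat -> 'rV[R]_q) (y : nat -> 'rV[R]_p) (tau delta : nat -> R).
Hypothesis hrun : PDAcL_run g f Phi gx gy psi xi phi tau_max nu mu eta beta M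
            x z y tau delta.

Local Notation omega := (omega_of psi xi phi).
Local Notation r := (r_seq omega beta x y delta).
Local Notation c := (c_seq eta M r).

Let Dxs : DX xs. Proof. by case: hOmega. Qed.
Let Dys : DY ys. Proof. by case: hOmega. Qed.

Lemma z_rec n : z n.+1 = ((psi - 1) / psi) *: x n + psi^-1 *: z n.
Proof. by case: hrun => _ _ _ _ /(_ n.+1 isT) []. Qed.

Lemma x_prox n : is_prox (tau n) g (z n.+1 - tau n *: gx (x n) (y n)) (x n.+1).
Proof. by case: hrun => _ _ _ _ /(_ n.+1 isT) []. Qed.

Lemma delta_rec n : delta n.+1 = tau n.+1 / tau n.
Proof. by case: hrun => _ _ _ _ /(_ n.+1 isT) []. Qed.

(** Here and in the next two definitions, index [n] describes iteration [n.+1], which removes the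
    predecessors. *)
Definition step_cap n := Num.min (phi * tau n) tau_max.
Definition trial_point n (t : R) (yt : 'rV[R]_p) :=
  is_prox (beta * t) (fenchel_conj f) (y n + (beta * t) *: gy (x n.+1) (y n)) yt.
Definition accepted n (t : R) (yt : 'rV[R]_p) :=
  ls_ok Phi gx gy omega xi nu beta (tau n) t (delta n) (x n.+1) (x n) (y n) yt (c n.+1).

Lemma line_search n : exists i : nat,
  [/\ tau n.+1 = step_cap n * mu ^+ i, trial_point n (tau n.+1) (y n.+1),
      accepted n (tau n.+1) (y n.+1) &
      forall j : nat, (j < i)%N ->
        forall yt, trial_point n (step_cap n * mu ^+ j) yt ->
          ~ accepted n (step_cap n * mu ^+ j) yt].
Proof. by case: hrun => _ _ _ _ /(_ n.+1 isT) []. Qed.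

Lemma tau_bounds n : 0 < tau n <= tau_max.
Proof.
have [mu0 mu1] := andP hmu.
elim: n => [|n /andP[IH _]]; first by case: hrun.
have [i [-> _ _ _]] := line_search n.
have t0 : 0 < step_cap n by rewrite lt_min htau_max andbT mulr_gt0 //; have := hphi; lra.
rewrite mulr_gt0 ?exprn_gt0 //=.
apply: (@le_trans _ _ (step_cap n)); last by rewrite ge_min lexx orbT.
by rewrite ler_piMr ?(ltW t0) // exprn_ile1 // ltW.
Qed.

Let tau0 n : 0 < tau n. Proof. by case/andP: (tau_bounds n). Qed.

Lemma tau_le_phi n : tau n.+1 <= phi * tau n.
Proof.
have [mu0 mu1] := andP hmu; have [i [-> _ _ _]] := line_search n.
apply: (@le_trans _ _ (step_cap n)); last by rewrite ge_min lexx.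
rewrite ler_piMr ?exprn_ile1 ?(ltW mu0) ?(ltW mu1) //.
by rewrite le_min (ltW htau_max) andbT mulr_ge0 ?(ltW (tau0 n)) //; have := hphi; lra.
Qed.

Lemma delta_gt0 n : 0 < delta n.
Proof.
case: n => [|n]; last by rewrite delta_rec divr_gt0.
by case: hrun => _ _ _ [_ ->].
Qed.

Lemma x_dom n : DX (x n).
Proof.
case: n => [|n]; first by case: hrun.
exact: is_prox_edom Dxs (x_prox n).
Qed.

Lemma y_dom n : DY (y n).
Proof.
case: n => [|n]; first by case: hrun.
by have [i [_ yp _ _]] := line_search n; exact: is_prox_edom Dys yp.
Qed.

Lemma r_ge0 n : 0 <= r n.
Proof.
rewrite addr_ge0 // mulr_ge0 ?sqr_ge0 ?invr_ge0 ?(ltW hbeta) //.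
by rewrite mulr_ge0 ?(ltW homega) // ltW // delta_gt0.
Qed.

(** * Primal-dual gap and energy estimate *)

(** The function [J] separates: [J(u, v)] is [gap_x u + gap_y v] minus the same sum at [(xs, ys)],
    where [Phi xs ys] cancels. *)
Definition gap_x u := G u + Phi u ys.
Definition gap_y v := F v - Phi xs v.

(** The subgradient inequality for [g] and the gradient inequality for [Phi] at [xs] have opposite
    linear terms. *)
Lemma saddle_x u : DX u -> gap_x xs <= gap_x u.
Proof.
move=> Du; have H := grad_x_le Dys Dxs Du.
have [_ _ /(_ u) S _] := hOmega; move: S.
by rewrite (edom_fin gN Dxs) (edom_fin gN Du) -EFinD lee_fin dotvNl /gap_x /=; lra.
Qed.

Lemma saddle_y v : DY v -> gap_y ys <= gap_y v.
Proof.
move=> Dv; have H := grad_y_ge Dxs Dys Dv.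
have [_ _ _ /(_ v) S] := hOmega; move: S.
by rewrite (edom_fin fN Dys) (edom_fin fN Dv) -EFinD lee_fin /gap_y /=; lra.
Qed.

Definition gap n := (gap_x (x n) + gap_y (y n)) - (gap_x xs + gap_y ys).

Lemma gap_ge0 n : 0 <= gap n.
Proof.
by have := saddle_x (x_dom n); have := saddle_y (y_dom n); rewrite /gap; lra.
Qed.

(** The last term is the [x] part of [r n.+1]: one step produces it and the line-search test of the
    next consumes it. *)
Definition energy n := psi / (psi - 1) * norm2 (z n.+2 - xs) ^+ 2
  + beta^-1 * norm2 (y n - ys) ^+ 2 + omega * delta n * norm2 (x n.+1 - x n) ^+ 2.

Lemma energy_step n : 2 * tau n.+1 * gap n.+1 + energy n.+1
  <= energy n + (1 - nu) * (c n.+1 - r n.+1).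
Proof.
have [i [_ yp ls _]] := line_search n.
have P := primal_step hpsi hxi (tau0 n.+1) (tau0 n) (tau_le_phi n)
  (z_rec n.+1) (z_rec n.+2)
  (is_prox_variational gN cg (tau0 n.+1) Dxs (x_prox n.+1))
  (is_prox_variational gN cg (tau0 n) (x_dom n.+2) (x_prox n)).
have bt : 0 < beta * tau n.+1 by rewrite mulr_gt0.
have Q := dual_step hbeta (tau0 n.+1) (is_prox_variational fN cf bt Dys yp).
(* Together with [H2], this cancels [Phi (x n.+1) (y n.+1)] and [Phi (x n.+1) (y n)] against the
   line-search test, leaving the two coupling values of the gap. *)
have H1 : tau n.+1 * (Phi (x n.+1) (y n.+1) + dotv (gx (x n.+1) (y n.+1)) (xs - x n.+1))
    <= tau n.+1 * Phi xs (y n.+1).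
  by rewrite ler_pM2l //; apply: grad_x_le => //; [exact: y_dom|exact: x_dom].
have H2 : tau n.+1 * Phi (x n.+1) ys
    <= tau n.+1 * (Phi (x n.+1) (y n) + dotv (gy (x n.+1) (y n)) (ys - y n)).
  by rewrite ler_pM2l //; apply: grad_y_ge => //; [exact: x_dom|exact: y_dom].
have {}ls : tau n.+1 * tau n / xi
      * norm2 (gx (x n.+1) (y n.+1) - gx (x n) (y n)) ^+ 2
    + 2 * tau n.+1 * (Phi (x n.+1) (y n) + dotv (gy (x n.+1) (y n)) (y n.+1 - y n)
        - Phi (x n.+1) (y n.+1))
    <= nu * r n.+1 + (1 - nu) * c n.+1 by [].
have rE : r n.+1 = omega * delta n * norm2 (x n.+1 - x n) ^+ 2
    + beta^-1 * norm2 (y n.+1 - y n) ^+ 2 by [].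
rewrite -delta_rec in P.
have D1 : dotv (gy (x n.+1) (y n)) (y n.+1 - y n) =
   dotv (gy (x n.+1) (y n)) (ys - y n) - dotv (gy (x n.+1) (y n)) (ys - y n.+1).
  by rewrite !dotvE; ring.
rewrite /energy /gap /gap_x /gap_y /=.
rewrite D1 in ls.
lra.
Qed.

Lemma energy_ge0 n : 0 <= energy n.
Proof.
rewrite !addr_ge0 // mulr_ge0 ?sqr_ge0 ?invr_ge0 ?(ltW hbeta) //.
  by rewrite divr_ge0 //; have := hpsi; lra.
by rewrite mulr_ge0 ?(ltW homega) // ltW // delta_gt0.
Qed.

(** A bound uniform in [N]: the initial energy plus the first [M] window averages, which the [r]
    terms do not absorb. *)
Definition budget := energy 0 + (1 - nu) * \sum_(1 <= n < M.+1) c n.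

Lemma energy_sum_le N :
  energy N + 2 * \sum_(1 <= n < N.+1) tau n * gap n <= budget.
Proof.
have [nu0 nu1] := andP hnu.
have H : energy N + 2 * \sum_(1 <= n < N.+1) tau n * gap n
    <= energy 0 + (1 - nu) * (\sum_(1 <= n < N.+1) c n - \sum_(1 <= n < N.+1) r n).
  elim: N => [|N IH]; first by rewrite !big_geq // subrr !mulr0.
  rewrite ![\sum_(1 <= _ < N.+2) _]big_nat_recr //=.
  by have := energy_step N; move: IH; lra.
have W := c_seq_sum_le heta hM r_ge0 N.
have nu1' : 0 <= 1 - nu by lra.
apply: le_trans H _; rewrite lerD2l ler_wpM2l //; move: W; lra.
Qed.

Lemma tau_gap_sum_le N : \sum_(1 <= n < N.+1) tau n * gap n <= budget.
Proof.
have H := energy_sum_le N; have E := energy_ge0 N.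
have S : 0 <= \sum_(1 <= n < N.+1) tau n * gap n.
  by apply: sumr_ge0 => k _; rewrite mulr_ge0 ?gap_ge0 // ltW.
lra.
Qed.

Lemma energy_le N : energy N <= budget.
Proof.
have H := energy_sum_le N.
have S : 0 <= \sum_(1 <= n < N.+1) tau n * gap n.
  by apply: sumr_ge0 => k _; rewrite mulr_ge0 ?gap_ge0 // ltW.
lra.
Qed.

(** * Boundedness of iterates and trial points *)

Lemma norm2_le_dist_sqr n (v w : 'rV[R]_n) (K : R) :
  norm2 (v - w) ^+ 2 <= K -> norm2 v <= norm2 w + K + 1.
Proof.
move=> H; have := norm2D (v - w) w; rewrite subrK => T.
by have := norm2_ge0 (v - w); nra.
Qed.

Lemma iterates_bounded : exists B : R, [/\ norm2 xs <= B, norm2 ys <= B &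
  forall n, norm2 (x n) <= B /\ norm2 (y n) <= B].
Proof.
have psi1 := hpsi; have b0 := hbeta.
have ph0 : 0 <= psi / (psi - 1) by rewrite divr_ge0; lra.
have ph1 : 1 <= psi / (psi - 1) by rewrite ler_pdivlMr; lra.
have yB n : norm2 (y n) <= norm2 ys + beta * budget + 1.
  apply: norm2_le_dist_sqr; rewrite -ler_pdivrMl //.
  apply: le_trans (energy_le n); rewrite /energy.
  have A1 : 0 <= psi / (psi - 1) * norm2 (z n.+2 - xs) ^+ 2.
    by rewrite mulr_ge0 ?sqr_ge0.
  have A2 : 0 <= omega * delta n * norm2 (x n.+1 - x n) ^+ 2.
    by rewrite mulr_ge0 ?sqr_ge0 // mulr_ge0 ?(ltW homega) // ltW // delta_gt0.
  lra.
have bud0 : 0 <= budget := le_trans (energy_ge0 0) (energy_le 0).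
pose Z := norm2 xs + budget + 1.
have zB n : norm2 (z n.+2) <= Z.
  apply: norm2_le_dist_sqr; apply: le_trans (energy_le n); rewrite /energy.
  have A1 : 0 <= beta^-1 * norm2 (y n - ys) ^+ 2.
    by rewrite mulr_ge0 ?sqr_ge0 ?invr_ge0 ?(ltW b0).
  have A2 : 0 <= omega * delta n * norm2 (x n.+1 - x n) ^+ 2.
    by rewrite mulr_ge0 ?sqr_ge0 // mulr_ge0 ?(ltW homega) // ltW // delta_gt0.
  have A3 := sqr_ge0 (norm2 (z n.+2 - xs)).
  by have := ler_wpM2r A3 ph1; rewrite mul1r; lra.
have psiN0 : psi != 0 by rewrite gt_eqF //; lra.
have psi1N0 : psi - 1 != 0 by rewrite gt_eqF //; lra.
have xB n : norm2 (x n.+2) <= psi / (psi - 1) * Z + (psi - 1)^-1 * Z.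
  (* The averaging recursion is solved for [x], so bounds on [z] carry over. *)
  have -> : x n.+2 = (psi / (psi - 1)) *: z n.+3 + (- (psi - 1)^-1) *: z n.+2.
    by rewrite (z_rec n.+2); apply/rowP => i; rewrite !mxE; field; rewrite psi1N0.
  apply: le_trans (norm2D _ _) _; rewrite !norm2Z normrN !ger0_norm ?invr_ge0 //; last by lra.
  by rewrite lerD // ler_wpM2l ?invr_ge0 ?zB //; lra.
have xs0 := norm2_ge0 xs; have ys0 := norm2_ge0 ys.
have Z0 : 0 <= Z by rewrite /Z; lra.
have Z1 : 0 <= psi / (psi - 1) * Z + (psi - 1)^-1 * Z.
  by rewrite addr_ge0 // mulr_ge0 // invr_ge0; lra.
have bb : 0 <= beta * budget by rewrite mulr_ge0 // ltW.
have x00 := norm2_ge0 (x 0); have x10 := norm2_ge0 (x 1).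
move: (psi / (psi - 1) * Z + (psi - 1)^-1 * Z) xB Z1 => Z' xB Z1.
(* The energy controls [z] only from index [2] on, hence [x] from index [2] on; [x 0] and [x 1] are
   added by hand. *)
exists (norm2 xs + norm2 ys + (beta * budget + 1) + Z' + norm2 (x 0) + norm2 (x 1)).
split=> [||n]; [lra|lra|split; last by have := yB n; lra].
case: n => [|[|n]]; [lra|lra|have := xB n; lra].
Qed.

(** Rejected trial points must be bounded before Lipschitz constants can be chosen on a set
    containing them. The prox inequality tested at [ys] involves gradients at [y n] and [ys] only,
    and leads to [|yt - ys|^2 <= K |yt - ys|]. *)
Lemma trial_bounded : exists B : R, [/\ norm2 xs <= B, norm2 ys <= B,
  forall n, norm2 (x n) <= B /\ norm2 (y n) <= B &
  forall n t yt, 0 < t <= tau_max -> trial_point n t yt -> norm2 yt <= B].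
Proof.
have [B [xsB ysB xyB]] := iterates_bounded.
have eX : ebounded [set u : 'rV[R]_q | norm2 u <= B] by exists B.
have eY1 : ebounded [set v : 'rV[R]_p | norm2 (v - ys) <= 1].
  exists (1 + B) => v /= v1; have := norm2D (v - ys) ys; rewrite subrK; lra.
have eY : ebounded [set v : 'rV[R]_p | norm2 v <= B] by exists B.
have [? [Lxx [Lxy [_ _ Lxy0 _ Lx]]]] := hLip eX eY1.
have [Lyy [? [? [Lyy0 _ _ Ly _]]]] := hLip eX eY.
have B0 : 0 <= B := le_trans (norm2_ge0 _) xsB.
pose K := 2 * B + beta * tau_max * (Lyy * (2 * B) + Lxy * (2 * B)).
have dB (k : nat) (u v : 'rV[R]_k) : norm2 u <= B -> norm2 v <= B -> norm2 (u - v) <= 2 * B.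
  by move=> ? ?; have := norm2D u (- v); rewrite norm2N; lra.
have LB0 : 0 <= Lyy * (2 * B) + Lxy * (2 * B).
  by rewrite addr_ge0 // mulr_ge0 //; lra.
have bt0 : 0 < beta * tau_max by rewrite mulr_gt0.
have K0 : 0 <= K by rewrite /K addr_ge0 ?(mulr_ge0 (ltW bt0)) //; lra.
exists (B + K); split=> [||n|n t yt /andP[t0 tm] yp]; [lra|lra|have [] := xyB n; lra|].
have [xB yB] := xyB n.+1; have [_ yB'] := xyB n.
have bt : 0 < beta * t by rewrite mulr_gt0.
have Dyt := is_prox_edom Dys yp.
have V := is_prox_variational fN cf bt Dys yp.
have S : fine (fenchel_conj f ys) + dotv (gy xs ys) (yt - ys) <= fine (fenchel_conj f yt).
  have [_ _ _ /(_ yt)] := hOmega.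
  by rewrite (edom_fin fN Dys) (edom_fin fN Dyt) -EFinD lee_fin.
have Gd : dotv (gy (x n.+1) ys - gy xs ys) (yt - ys)
    <= Lxy * norm2 (yt - ys) * norm2 (x n.+1 - xs).
  apply: (@gy_diff_le Lxy B) => //; [exact: ltW|exact: x_dom|].
  move=> u v v' Du uB Dv v1 Dv' v1'.
  by have := Lx u u v v' uB Du uB Du v1 Dv v1' Dv'; rewrite subrr norm20 mulr0 add0r.
have Gy : dotv (gy (x n.+1) (y n) - gy (x n.+1) ys) (yt - ys)
    <= Lyy * norm2 (y n - ys) * norm2 (yt - ys).
  apply: le_trans (dotv_le_norm2 _ _) _; rewrite ler_wpM2r ?norm2_ge0 //.
  by apply: Ly => //; [exact: x_dom|exact: y_dom].
have Dn := norm2_ge0 (yt - ys).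
have Cs := dotv_le_norm2 (y n - ys) (yt - ys).
have E : dotv (yt - ys) (yt - ys) <= dotv (y n - ys) (yt - ys)
   + beta * t * dotv (gy (x n.+1) (y n) - gy xs ys) (yt - ys).
  have {}V : dotv (yt - ys) (yt - ys) <= dotv (y n - ys) (yt - ys)
     + beta * t * dotv (gy (x n.+1) (y n)) (yt - ys)
     + beta * t * (fine (fenchel_conj f ys) - fine (fenchel_conj f yt)).
    by move: V; rewrite !dotvE; lra.
  apply: le_trans V _; rewrite -addrA lerD2l -mulrDr ler_pM2l //.
  by move: S; rewrite (dotvDl (gy _ _)) dotvNl; lra.
have T : dotv (gy (x n.+1) (y n) - gy xs ys) (yt - ys)
    <= (Lyy * (2 * B) + Lxy * (2 * B)) * norm2 (yt - ys).
  (* The intermediate gradient at [(x n.+1, ys)] separates the change in [y] from the change in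
     [x]. *)
  rewrite -(subrKA (gy (x n.+1) ys)) (dotvDl (gy _ _ - _)).
  apply: le_trans (lerD Gy Gd) _.
  rewrite [X in _ <= X]mulrDl lerD //; first by rewrite ler_wpM2r // ler_wpM2l // dB.
  by rewrite mulrAC ler_wpM2r // ler_wpM2l ?(ltW Lxy0) // dB.
have U : norm2 (yt - ys) ^+ 2 <= K * norm2 (yt - ys).
  rewrite norm2_sqr; apply: le_trans E _; rewrite /K mulrDl lerD //.
    by apply: le_trans Cs _; rewrite ler_wpM2r // dB.
  apply: (@le_trans _ _ (beta * t * ((Lyy * (2 * B) + Lxy * (2 * B)) * norm2 (yt - ys)))).
    by rewrite ler_pM2l.
  by rewrite mulrA ler_wpM2r // ler_wpM2r // ler_pM2l.
have dK : norm2 (yt - ys) <= K.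
  rewrite leNgt; apply/negP => kd; have d0 : 0 < norm2 (yt - ys) by lra.
  by move: U; rewrite expr2 ler_pM2r // leNgt kd.
by have := norm2D (yt - ys) ys; rewrite subrK; lra.
Qed.

(** * Lower bound on the step sizes *)

(** In the line search this trades the factor [tau n] for the weight [delta n] that [r] puts on the
    [x] increment. *)
Lemma tau_le_delta n : tau n <= delta n * tau_max.
Proof.
case: n => [|n]; last first.
  rewrite delta_rec mulrAC -mulrA ler_peMr ?(ltW (tau0 _)) //.
  by rewrite ler_pdivlMr // mul1r; case/andP: (tau_bounds n).
have -> : delta 0 = 1 by case: hrun => _ _ _ [].
by rewrite mul1r; case/andP: (tau_bounds 0).
Qed.

(** By contraposition: the Lipschitz bounds make the left side of the test at most a combination of
    the squared [x] and [y] increments, and for small [t] it is below [nu] times the trial value of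
    [r]; the window average is nonnegative. *)
Lemma rejected_step_ge : exists t0 : R, 0 < t0 /\
  forall n t yt, 0 < t <= tau_max -> trial_point n t yt -> ~ accepted n t yt -> t0 <= t.
Proof.
have [B [_ _ xyB trB]] := trial_bounded.
have eX : ebounded [set u : 'rV[R]_q | norm2 u <= B] by exists B.
have eY : ebounded [set v : 'rV[R]_p | norm2 v <= B] by exists B.
have [Lyy [Lxx [Lxy [Lyy0 Lxx0 Lxy0 Ly Lx]]]] := hLip eX eY.
have [nu0 nu1] := andP hnu; have xi0 := hxi; have tm0 := htau_max; have om0 := homega.
have b0 := hbeta.
have k10 : 0 < tau_max * 2 * (Lxx ^+ 2 + 1).
  by rewrite !mulr_gt0 // ltr_wpDl ?sqr_ge0.
have LL0 : 0 <= tau_max / xi * (2 * Lxy ^+ 2).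
  by rewrite mulr_ge0 ?divr_ge0 ?(ltW tm0) ?(ltW xi0) // mulr_ge0 ?sqr_ge0.
have k20 : 0 < beta * (tau_max / xi * (2 * Lxy ^+ 2) + 2 * Lyy + 1).
  by rewrite mulr_gt0 //; lra.
(* Below [t1] the coefficient of the squared [x] increment is at most [nu omega delta n]; below [t2]
   that of the [y] increment is at most [nu / beta]. *)
pose t1 := nu * omega * xi / (tau_max * 2 * (Lxx ^+ 2 + 1)).
pose t2 := nu / (beta * (tau_max / xi * (2 * Lxy ^+ 2) + 2 * Lyy + 1)).
exists (Num.min t1 t2); split.
  by rewrite lt_min /t1 /t2 !divr_gt0 // !mulr_gt0.
move=> n t yt /andP[tpos tm] yp nok; rewrite leNgt lt_min; apply/negP => /andP[tt1 tt2].
apply: nok; rewrite /accepted /ls_ok.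
have [xB _] := xyB n.+1; have [xB' yB'] := xyB n.
have ytB : norm2 yt <= B by apply: (trB n t) => //; rewrite tpos.
have Dyt := is_prox_edom Dys yp.
have Dx1 := x_dom n.+1; have Dx0 := x_dom n; have Dy0 := y_dom n.
have Pg := grad_y_ge Dx1 Dyt Dy0.
have Gy : dotv (gy (x n.+1) (y n) - gy (x n.+1) yt) (yt - y n) <= Lyy * norm2 (yt - y n) ^+ 2.
  apply: le_trans (dotv_le_norm2 _ _) _; rewrite expr2 mulrA ler_wpM2r ?norm2_ge0 //.
  by rewrite (norm2B yt); exact: Ly.
have Th : norm2 (gx (x n.+1) yt - gx (x n) (y n)) ^+ 2
    <= 2 * Lxx ^+ 2 * norm2 (x n.+1 - x n) ^+ 2 + 2 * Lxy ^+ 2 * norm2 (yt - y n) ^+ 2.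
  have := Lx _ _ _ _ xB Dx1 xB' Dx0 ytB Dyt yB' Dy0.
  set a := norm2 (_ - gx _ _); set u := norm2 _; set v := norm2 _ => H.
  apply: (@le_trans _ _ ((Lxx * u + Lxy * v) ^+ 2)).
    by rewrite ler_sqr ?nnegrE ?norm2_ge0 // addr_ge0 // mulr_ge0 ?norm2_ge0 // ltW.
  by have := sqr_ge0 (Lxx * u - Lxy * v); lra.
have Ph : Phi (x n.+1) (y n) + dotv (gy (x n.+1) (y n)) (yt - y n) - Phi (x n.+1) yt
    <= Lyy * norm2 (yt - y n) ^+ 2.
  apply: le_trans Gy; move: Pg; rewrite -(opprB yt) dotvNr (dotvDl (gy _ _)) dotvNl; lra.
have c0 := c_seq_ge0 M heta r_ge0 n.+1.
have dl := tau_le_delta n; have d0 := delta_gt0 n; have ta0 := tau0 n.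
have [_ tam] := andP (tau_bounds n).
move: (norm2_ge0 (x n.+1 - x n)) (norm2_ge0 (yt - y n)) => u0 v0.
move: (sqr_ge0 (norm2 (x n.+1 - x n))) (sqr_ge0 (norm2 (yt - y n))) Th Ph.
set a := norm2 (_ - gx _ _) ^+ 2; set ph := _ + _ - _.
set u := norm2 _ ^+ 2; set v := norm2 _ ^+ 2 => uu0 vv0 Th Ph.
have {}tt1 : t * (tau_max * 2 * (Lxx ^+ 2 + 1)) <= nu * omega * xi.
  by rewrite -ler_pdivlMr // ltW.
have {}tt2 : t * (beta * (tau_max / xi * (2 * Lxy ^+ 2) + 2 * Lyy + 1)) <= nu.
  by rewrite -ler_pdivlMr // ltW.
have ttx : 0 <= t * tau n / xi by rewrite divr_ge0 ?(ltW xi0) // mulr_ge0 // ltW.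
have P1 : t * tau n / xi * a <= t * tau n / xi * (2 * Lxx ^+ 2 * u + 2 * Lxy ^+ 2 * v).
  exact: ler_wpM2l.
have P2 : 2 * t * ph <= 2 * t * (Lyy * v) by rewrite ler_wpM2l //; lra.
have Q1 : t * tau n / xi * (2 * Lxx ^+ 2) <= nu * omega * delta n.
  rewrite mulrAC ler_pdivrMr //.
  apply: (@le_trans _ _ (delta n * (t * (tau_max * 2 * (Lxx ^+ 2 + 1))))).
    have -> : delta n * (t * (tau_max * 2 * (Lxx ^+ 2 + 1))) =
      t * (delta n * tau_max) * (2 * Lxx ^+ 2) + 2 * t * delta n * tau_max by ring.
    apply: ler_wpDr; first by rewrite !mulr_ge0 // ltW.
    by rewrite ler_wpM2r ?mulr_ge0 ?sqr_ge0 // ler_pM2l.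
  have -> : nu * omega * delta n * xi = delta n * (nu * omega * xi) by ring.
  by rewrite ler_pM2l.
have Q2 : t * tau n / xi * (2 * Lxy ^+ 2) + 2 * t * Lyy <= nu * beta^-1.
  rewrite ler_pdivlMr //; apply: le_trans tt2.
  have -> : t * (beta * (tau_max / xi * (2 * Lxy ^+ 2) + 2 * Lyy + 1)) =
     (t * (tau_max / xi * (2 * Lxy ^+ 2)) + 2 * t * Lyy) * beta + t * beta by ring.
  apply: ler_wpDr; first by rewrite mulr_ge0 // ltW.
  rewrite ler_pM2r // lerD2r -!mulrA ler_pM2l // ler_wpM2r //.
  by rewrite mulr_ge0 ?invr_ge0 ?(ltW xi0) // mulr_ge0 ?sqr_ge0.
have := ler_wpM2r uu0 Q1; have := ler_wpM2r vv0 Q2.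
have := mulr_ge0 (_ : 0 <= 1 - nu) c0; rewrite subr_ge0 => /(_ (ltW nu1)).
move: P1 P2; move: (t * tau n / xi) => tx.
lra.
Qed.

Lemma tau_bounded_below : exists t0 : R, 0 < t0 /\ forall n, t0 <= tau n.
Proof.
have [t0 [t00 rej]] := rejected_step_ge.
have [mu0 mu1] := andP hmu.
exists (Num.min (tau 0) (t0 * mu)); split; first by rewrite lt_min tau0 mulr_gt0.
elim=> [|n IH]; first by rewrite ge_min lexx.
(* If the first trial passes, the step is [step_cap n], no smaller than [tau n]. Otherwise the last
   rejected step is the accepted one divided by [mu]. *)
have [[|j] [-> _ _ fails]] := line_search n.
  rewrite expr0 mulr1 /step_cap le_min; have [ta0 tam] := andP (tau_bounds n).
  apply/andP; split; last exact: le_trans tam.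
  by apply: le_trans IH _; rewrite ler_peMl ?(ltW ta0) // ltW.
have t0' : 0 < step_cap n.
  by rewrite lt_min htau_max andbT mulr_gt0 //; have := hphi; lra.
have tj : 0 < step_cap n * mu ^+ j <= tau_max.
  rewrite mulr_gt0 ?exprn_gt0 //=; apply: (@le_trans _ _ (step_cap n)).
    by rewrite ler_piMr ?(ltW t0') // exprn_ile1 // ltW.
  by rewrite ge_min lexx orbT.
have btj : 0 < beta * (step_cap n * mu ^+ j) by rewrite mulr_gt0 //; case/andP: tj.
(* Minimality of [i] only excludes trial points that exist, so one has to be produced for the
   rejected step. *)
have [yt yp] := fenchel_prox_exists (y n + (beta * (step_cap n * mu ^+ j)) *: gy (x n.+1) (y n))
  pf (ex_intro _ ys Dys) btj.
have := rej n _ yt tj yp (fails j (ltnSn j) yt yp) => H.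
rewrite exprSr mulrA ge_min; apply/orP; right.
by rewrite ler_pM2r.
Qed.

(** * Ergodic rate by Jensen's inequality *)

Lemma ergodic_rate : exists C1 : R, 0 < C1 /\
    forall N : nat, (1 <= N)%N ->
      (Lagr g f Phi (wavg tau x N) ys - Lagr g f Phi xs (wavg tau y N)
         <= (C1 / N%:R)%:E)%E.
Proof.
have [t0 [t00 tlow]] := tau_bounded_below.
have bud0 : 0 <= budget := le_trans (energy_ge0 0) (energy_le 0).
(* The weights sum to at least [N t0], which gives [budget / t0]; the added [1] ensures strict
   positivity. *)
exists ((budget + 1) / t0); split; first by rewrite divr_gt0 //; lra.
move=> N N1.
have [Dx Jx] := wavg_convex tau0 x_dom (convex_on_Phi_x Dys) N1.
have [Dy Jy] := wavg_convex tau0 y_dom (convex_on_Phi_y Dxs) N1.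
rewrite /Lagr (edom_fin gN Dx) (edom_fin gN Dxs) (edom_fin fN Dy) (edom_fin fN Dys).
rewrite -!(EFinB, EFinD) lee_fin.
have S0 := psumr_weights_gt0 tau0 N1.
have Slow : N%:R * t0 <= \sum_(1 <= k < N.+1) tau k.
  rewrite mulr_natl -[X in t0 *+ X](subn1 N.+1) -sumr_const_nat.
  by apply: ler_sum => k _.
have gapS := tau_gap_sum_le N.
have gE : \sum_(1 <= n < N.+1) tau n * gap n =
    \sum_(1 <= n < N.+1) tau n * (G (x n) + Phi (x n) ys)
    + \sum_(1 <= n < N.+1) tau n * (F (y n) - Phi xs (y n))
    - (\sum_(1 <= n < N.+1) tau n) * (gap_x xs + gap_y ys).
  rewrite mulr_suml -big_split -sumrB; apply: eq_bigr => k _.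
  by rewrite /gap /gap_x /gap_y /=; ring.
move: Jx Jy Slow S0 gapS; rewrite gE /gap_x /gap_y /=.
move: (\sum_(1 <= n < N.+1) tau n) => S Jx Jy Slow S0 gapS.
set J := (X in X <= _).
have JS : S * J <= budget by rewrite /J; lra.
have N0 : 0 < N%:R :> R by rewrite ltr0n.
rewrite ler_pdivlMr // ler_pdivlMr //.
have [J0|J0] := leP J 0.
  by have := mulr_ge0 (ltW N0) (ltW t00); nra.
by have := ler_wpM2l (ltW J0) Slow; lra.
Qed.

End PDAcL.

Unset Implicit Arguments.
Set Strict Implicit.
Set Printing Implicit Defensive.

Theorem theorem3p2 (R : realType) (p q : nat)
  (f : 'rV[R]_p -> \bar R) (g : 'rV[R]_q -> \bar R)
  (Phi : 'rV[R]_q -> 'rV[R]_p -> R)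
  (gx : 'rV[R]_q -> 'rV[R]_p -> 'rV[R]_q)
  (gy : 'rV[R]_q -> 'rV[R]_p -> 'rV[R]_p)
  (* f, g proper closed convex *)
  (hf : proper_closed_convex f) (hg : proper_closed_convex g)
  (* Phi continuous on dom g x dom f^* *)
  (hPhi_cont : {within [set xy : 'rV[R]_q * 'rV[R]_p |
                          edom g xy.1 /\ edom (fenchel_conj f) xy.2],
                continuous (fun xy : 'rV[R]_q * 'rV[R]_p => Phi xy.1 xy.2)})
  (* (A2): Phi(.,y) convex and differentiable with gradient gx(.,y) *)
  (hPhi_x : forall y, edom (fenchel_conj f) y ->
     (forall a b (t : R), edom g a -> edom g b -> 0 < t < 1 ->
        Phi (t *: a + (1 - t) *: b) y <= t * Phi a y + (1 - t) * Phi b y) /\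
     (forall x, edom g x ->
        differentiable (fun u => Phi u y) x /\
        forall h, 'd (fun u => Phi u y) x h = dotv (gx x y) h))
  (* (A2): Phi(x,.) concave and differentiable with gradient gy(x,.) *)
  (hPhi_y : forall x, edom g x ->
     (forall a b (t : R), edom (fenchel_conj f) a -> edom (fenchel_conj f) b ->
        0 < t < 1 ->
        t * Phi x a + (1 - t) * Phi x b <= Phi x (t *: a + (1 - t) *: b)) /\
     (forall y, edom (fenchel_conj f) y ->
        differentiable (fun v => Phi x v) y /\
        forall h, 'd (fun v => Phi x v) y h = dotv (gy x y) h))
  (* (A2): local Lipschitz-type bounds on bounded sets *)
  (hLip : forall (X : set 'rV[R]_q) (Y : set 'rV[R]_p), ebounded X -> ebounded Y ->
     exists Lyy Lxx Lxy : R, [/\ 0 <= Lyy, 0 <= Lxx, 0 < Lxy,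
       (forall x y y', X x -> edom g x -> Y y -> edom (fenchel_conj f) y ->
          Y y' -> edom (fenchel_conj f) y' ->
          norm2 (gy x y - gy x y') <= Lyy * norm2 (y - y')) &
       (forall x x' y y', X x -> edom g x -> X x' -> edom g x' ->
          Y y -> edom (fenchel_conj f) y -> Y y' -> edom (fenchel_conj f) y' ->
          norm2 (gx x y - gx x' y') <= Lxx * norm2 (x - x') + Lxy * norm2 (y - y'))])
  (* a fixed saddle point (xs, ys) in Omega (so Omega is nonempty), L finite there *)
  (xs : 'rV[R]_q) (ys : 'rV[R]_p) (hOmega : in_Omega g f gx gy xs ys)
  (hLfin : Lagr g f Phi xs ys \is a fin_num)
  (* parameters of PDAc-L *)
  (psi xi phi tau_max nu mu eta beta : R) (M : nat)
  (hpsi : 1 < psi < 1 + Num.sqrt 3) (hxi : 0 < xi) (hphi : 1 < phi)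
  (homega : 0 < omega_of psi xi phi) (htau_max : 0 < tau_max)
  (hnu : 0 < nu < 1) (hmu : 0 < mu < 1) (heta : 0 <= eta < 1)
  (hM : (1 <= M)%N) (hbeta : 0 < beta)
  (* the iterates generated by PDAc-L *)
  (x z : nat -> 'rV[R]_q) (y : nat -> 'rV[R]_p) (tau delta : nat -> R)
  (hrun : PDAcL_run g f Phi gx gy psi xi phi tau_max nu mu eta beta M
            x z y tau delta) :
  exists C1 : R, 0 < C1 /\
    forall N : nat, (1 <= N)%N ->
      (Lagr g f Phi (wavg tau x N) ys - Lagr g f Phi xs (wavg tau y N)
         <= (C1 / N%:R)%:E)%E.
Proof.
have [psi1 _] := andP hpsi.
exact: (ergodic_rate hf hg hPhi_x hPhi_y hLip hOmega psi1 hxi hphi homega htau_max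
  hnu hmu heta hM hbeta hrun).
Qed.
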